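(* There exist absolute constants $c_0,C>0$ such that for all integers $d\ge2$ and all integers $n\ge C\,d^{(d+3)/2}\ln d$, $$n\cdot\operatorname{disp}_{\mathcal C}(n,d)\ge c_0\,d .$$
   Context: $\mathbb S^d\subset\mathbb R^{d+1}$ is the Euclidean unit sphere, $\sigma$ the normalized (total mass $1$) Lebesgue surface measure on $\mathbb S^d$. The family of spherical caps is $\mathcal C=\{B(x,\varphi):x\in\mathbb S^d,\varphi\in[0,\pi]\}$, where $B(x,\varphi)=\{y\in\mathbb S^d:\arccos\langle x,y\rangle\le\varphi\}$. The minimal spherical cap dispersion is $$\operatorname{disp}_{\mathcal C}(n,d)=\inf_{x_1,\dots,x_n\in\mathbb S^d}\ \sup\{\sigma(A): A\in\mathcal C,\ A\cap\{x_1,\dots,x_n\}=\emptyset\}.$$ *)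

(* Defs.v *)
From HB Require Import structures.
From mathcomp Require Import all_boot all_order all_algebra.
From mathcomp Require Import all_classical all_reals all_analysis.

Set Implicit Arguments.
Unset Strict Implicit.
Unset Printing Implicit Defensive.

Import Order.TTheory GRing.Theory Num.Theory.
Import numFieldNormedType.Exports.

Local Open Scope classical_set_scope.
Local Open Scope ring_scope.

(* If mu is a measure on R^n, the measure lebesgue_measure \x mu transported to
   R^(n+1) by prepending the first coordinate. *)
Section lebesgue_step.
Local Open Scope ereal_scope.
Context (R : realType) (n : nat).
Local Notation mR := (measurableTypeR R).
Variable mu : {sigma_finite_measure set (n.-tuple mR) -> \bar R}.

Definition tuple_of_pair (p : mR * n.-tuple mR) : n.+1.-tuple mR :=
  [the n.+1.-tuple mR of p.1 :: p.2].

Definition pair_of_tuple (t : n.+1.-tuple mR) : mR * n.-tuple mR :=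
  (thead t, [tuple of behead t]).

Lemma tuple_of_pairK : cancel tuple_of_pair pair_of_tuple.
Proof. by case=> x t; congr pair; exact: val_inj. Qed.

Lemma measurable_tuple_of_pair : measurable_fun setT tuple_of_pair.
Proof. exact: measurable_cons. Qed.

Lemma measurable_pair_of_tuple : measurable_fun setT pair_of_tuple.
Proof.
apply/measurable_fun_pairP; split; last exact: measurable_behead.
exact: measurable_tnth.
Qed.

Definition lebesgue_step : set (n.+1.-tuple mR) -> \bar R :=
  pushforward (@lebesgue_measure R \x mu) tuple_of_pair.

Let step0 : lebesgue_step set0 = 0.
Proof. by rewrite /lebesgue_step /pushforward preimage_set0 measure0. Qed.

Let step_ge0 A : 0 <= lebesgue_step A.
Proof. by rewrite /lebesgue_step /pushforward; exact: measure_ge0. Qed.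

Let step_sigma_additive : semi_sigma_additive lebesgue_step.
Proof.
move=> F mF tF mUF; rewrite /lebesgue_step /pushforward preimage_bigcup.
apply: measure_semi_sigma_additive.
- by move=> k; rewrite -[X in measurable X]setTI; exact: measurable_tuple_of_pair.
- apply/trivIsetP => /= i j _ _ ij; rewrite -preimage_setI.
  by move/trivIsetP : tF => /(_ _ _ _ _ ij) ->//; rewrite preimage_set0.
- rewrite -preimage_bigcup -[X in measurable X]setTI.
  exact: measurable_tuple_of_pair.
Qed.

HB.instance Definition _ := isMeasure.Build _ _ _ lebesgue_step
  step0 step_ge0 step_sigma_additive.

Let step_sigma_finite : sigma_finite setT lebesgue_step.
Proof.
have /sigma_finiteP[F [TF ndF Foo]] := sigma_finiteT (@lebesgue_measure R).
have /sigma_finiteP[G [TG ndG Goo]] := sigma_finiteT mu.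
exists (fun k => pair_of_tuple @^-1` (F k `*` G k)).
  rewrite -preimage_bigcup (_ : \bigcup_k _ = setT) ?preimage_setT //.
  rewrite -subTset -setXTT TF TG => -[x y] [/= [k _ Fx] [l _ Gy]].
  exists (maxn k l) => //; split.
    by move: x Fx; exact/subsetPset/ndF/leq_maxl.
  by move: y Gy; exact/subsetPset/ndG/leq_maxr.
move=> k; have [mF Fk] := Foo k; have [mG Gk] := Goo k; split.
  rewrite -[X in measurable X]setTI.
  by apply: measurable_pair_of_tuple => //; exact: measurableX.
rewrite /lebesgue_step /pushforward -comp_preimage.
rewrite (_ : _ \o _ = id) ?preimage_id; last first.
  by apply/funext => p; exact: tuple_of_pairK.
by rewrite product_measure1E// lte_mul_pinfty// ge0_fin_numE.
Qed.

HB.instance Definition _ := Measure_isSigmaFinite.Build _ _ _ lebesgue_step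
  step_sigma_finite.

End lebesgue_step.

(* Lebesgue measure on the Borel sets of R^n; on R^0 it is the unit point mass. *)
Fixpoint lebesgue_tuple (R : realType) (n : nat) :
    {sigma_finite_measure set (n.-tuple (measurableTypeR R)) -> \bar R} :=
  match n with
  | 0 => \d_([tuple] : 0.-tuple (measurableTypeR R))
  | m.+1 => lebesgue_step (lebesgue_tuple R m)
  end.

Lemma lebesgue_tuple_box (R : realType) (n : nat)
    (A : 'I_n -> set (measurableTypeR R)) : (forall i, measurable (A i)) ->
  lebesgue_tuple R n [set t | forall i, A i (tnth t i)] =
  (\prod_(i < n) lebesgue_measure (A i))%E.
Proof.
elim: n A => [|n IH] A mA.
  by rewrite big_ord0 /= diracE mem_set //; case.
rewrite big_ord_recl -IH; last by move=> i; exact: mA.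
rewrite /= /lebesgue_step /pushforward -product_measure1E //.
  congr (_ _); apply/seteqP; split=> [[x t]/= H|[x t] /= [Hx Ht]].
    split; first by have := H ord0; rewrite tnth0.
    by move=> i; have := H (lift ord0 i); rewrite tnthS.
  by move=> i; case: (unliftP ord0 i) => [j ->|->]; rewrite ?tnthS.
rewrite (_ : mkset _ = \bigcap_(i in [set: 'I_n])
    ((fun t : n.-tuple (measurableTypeR R) => tnth t i) @^-1` A (lift ord0 i))).
  apply: fin_bigcap_measurable => // i _.
  by rewrite -[X in measurable X]setTI; exact: measurable_tnth.
by apply/seteqP; split=> t /= H i => [_|]; exact: H.
Qed.

(* The product sigma-algebra is available on n.-tuple R and not on
   'rV[R]_n; the two types are identified coordinatewise. *)
Definition volume (R : realType) (n : nat) (A : set 'rV[R]_n) : \bar R :=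
  lebesgue_tuple R n [set t | A (\row_i tnth t i)].

Definition inner (R : realType) (n : nat) (x y : 'rV[R]_n) : R :=
  \sum_(i < n) x 0 i * y 0 i.

Definition sphere (R : realType) (d : nat) : set 'rV[R]_d.+1 :=
  [set x | Num.sqrt (inner x x) = 1].

Arguments sphere : clear implicits.

Definition cone (R : realType) (n : nat) (A : set 'rV[R]_n) : set 'rV[R]_n :=
  [set z | exists t : R, exists2 a, A a & 0 <= t <= 1 /\ z = t *: a].

(* By integration in polar coordinates, the surface area of A `<=` sphere R d is
   d.+1 times the volume of cone A; the factor d.+1 cancels when the total mass
   is normalized to 1. cone (sphere R d) is the closed unit ball. *)
Definition sigma (R : realType) (d : nat) (A : set 'rV[R]_d.+1) : \bar R :=
  (volume (cone A) / volume (cone (sphere R d)))%E.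

Definition cap (R : realType) (d : nat) (x : 'rV[R]_d.+1) (phi : R) :
    set 'rV[R]_d.+1 :=
  [set y | sphere R d y /\ acos (inner x y) <= phi].

Definition caps (R : realType) (d : nat) : set (set 'rV[R]_d.+1) :=
  [set B | exists x phi, [/\ sphere R d x, 0 <= phi <= pi & B = cap x phi]].

Arguments caps : clear implicits.

Definition disp_caps (R : realType) (n d : nat) : \bar R :=
  ereal_inf [set s | exists2 x : 'I_n -> 'rV[R]_d.+1,
    (forall i, sphere R d (x i)) &
    s = ereal_sup [set sigma A | A in
          [set A | caps R d A /\ A `&` range x = set0]]].

Arguments disp_caps : clear implicits.

(* Main.v *)
(* If the n closed caps of angle phi around the given points do not cover the sphere,
   then a cap of angle phi is empty; so it suffices to bound from below, by a constant
   times d, the density of a covering of the sphere by small caps (a spherical version of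
   the Coxeter-Few-Rogers bound), and then to choose phi so that n caps of angle phi have
   total measure just below that bound.
   Let the caps around the points x_i cover. A generic weighted convex hull of the x_i
   triangulates space into cones over simplices with vertices v_0, ..., v_d whose
   circumradius is at most about rho = sin phi. For a fixed vertex v_j the tangent cones
   at v_j of the simplices containing v_j are interior-disjoint, so the sectors that they
   cut out of the cap around v_j have total measure at most that of the cap. In one simplex,
   the sector at v_j, compared with the simplex, has volume about d times the mean of
   1 - |z - v_j| / rho over a suitable copy of the simplex; bounding the length by a
   quadratic form and summing over j, the second moments of the uniform distribution on a
   simplex show that the d+1 sectors together have at least a constant times d times the
   volume of the simplex.
   Linear changes of variables only enter through ratios of volumes, so uniqueness of
   translation-invariant measures replaces determinants. *)

Require Import Defs.
From HB Require Import structures.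
From mathcomp Require Import all_boot all_order all_algebra fingroup perm.
From mathcomp Require Import all_classical all_reals all_analysis.
From mathcomp Require Import measurable_realfun.
From mathcomp Require Import ring lra.

Set Implicit Arguments.
Unset Strict Implicit.
Unset Printing Implicit Defensive.

Import Order.TTheory GRing.Theory Num.Theory.

Local Open Scope classical_set_scope.
Local Open Scope ring_scope.


(** * Translation-invariant measures *)

(** The obstacle is that the mean of 1 - |z - v_j| / rho is only of order 1/d. In the extremal case
    of a regular simplex of circumradius rho, most points lie at distance close to rho from every
    vertex, and corrections of relative size 1/d to these distances can already make the bound
    negative. So the mean is taken over a copy shrunk by a factor t = 1 - O(1/d), which restores a
    positive mean of order 1/d at the cost of the constant factor t^d. The other losses have the
    same shape: the cosine gam and the perturbation e of the weights enter through powers of 1 +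
    O(1/d) with exponent about d, provided that d * rho^2 is bounded. The lower bound on n serves
    exactly this: n caps of total measure about d have tan phi at most of order n^(-1/d), whose
    square is O(1/d) once n is at least of order d^(d/2). Weights are perturbed because with equal
    weights more than d+1 points may lie on one face of the hull, which is then no simplex; the
    perturbation can be arbitrarily small, so it hardly affects the circumradius. *)

Section translation.
Local Open Scope ereal_scope.
Context (R : realType).
Local Notation mR := (measurableTypeR R).

Definition tadd n (a t : n.-tuple mR) : n.-tuple mR :=
  [tuple (tnth a i + tnth t i)%R | i < n].

Definition topp n (t : n.-tuple mR) : n.-tuple mR := [tuple (- tnth t i)%R | i < n].

Lemma measurable_tadd n d (T : measurableType d) (f g : T -> n.-tuple mR) :
  measurable_fun setT f -> measurable_fun setT g ->
  measurable_fun setT (fun t => tadd (f t) (g t)).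
Proof.
move=> mf mg; apply/measurable_fun_tnthP => i.
rewrite (_ : _ \o _ = (fun t => tnth (f t) i + tnth (g t) i)%R); last first.
  by apply/funext => t /=; rewrite tnth_mktuple.
apply: measurable_funD.
  by apply: (measurableT_comp (measurable_tnth i)).
by apply: (measurableT_comp (measurable_tnth i)).
Qed.

Lemma measurable_topp n d (T : measurableType d) (f : T -> n.-tuple mR) :
  measurable_fun setT f -> measurable_fun setT (fun t => topp (f t)).
Proof.
move=> mf; apply/measurable_fun_tnthP => i.
rewrite (_ : _ \o _ = (fun t => - tnth (f t) i)%R); last first.
  by apply/funext => t /=; rewrite tnth_mktuple.
apply: measurableT_comp; first exact: oppr_measurable.
by apply: (measurableT_comp (measurable_tnth i)).
Qed.

Lemma lebesgue_measure_addl (a : R) (A : set mR) : measurable A ->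
  lebesgue_measure ((fun x : mR => a + x)%R @^-1` A) = lebesgue_measure A.
Proof.
move=> mA; have mf : measurable_fun setT ((fun x : mR => a + x)%R : mR -> mR).
  exact: measurable_funD.
apply/esym.
rewrite -[RHS]/(pushforward lebesgue_measure ((fun x : mR => a + x)%R : mR -> mR) A).
apply: lebesgue_measure_unique => //= _ [[x y]] _ <-.
rewrite /pushforward /= (_ : _ @^-1` _ = `](x - a)%R, (y - a)%R]%classic); last first.
  by apply/seteqP; split => z /=; rewrite !in_itv /= ltrBlDl lerBrDl.
rewrite !lebesgue_measure_itv /= !lte_fin ltrD2r.
by case: ifP => // _; congr (_%:E); ring.
Qed.

Definition translation_invariant n (mu : set (n.-tuple mR) -> \bar R) :=
  forall a A, measurable A -> mu (tadd a @^-1` A) = mu A.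

Lemma measurable_preimage d d' (T : measurableType d) (T' : measurableType d')
    (f : T -> T') A : measurable_fun setT f -> measurable A -> measurable (f @^-1` A).
Proof. by move=> mf mA; rewrite -[X in measurable X]setTI; exact: mf. Qed.

Lemma lebesgue_tuple_translation n : translation_invariant (lebesgue_tuple R n).
Proof.
elim: n => [|n IH] a A mA.
  rewrite (_ : tadd a @^-1` A = A) //; apply/seteqP; split=> t /=;
    by rewrite (_ : tadd a t = t) //; apply: eq_from_tnth; case.
rewrite /= /lebesgue_step /pushforward /product_measure1 /=.
set B := (@tuple_of_pair R n) @^-1` A.
have mB : measurable B by apply: measurable_preimage => //; exact: measurable_tuple_of_pair.
pose F := (fun x : mR => lebesgue_tuple R n (xsection B x)).
have mF : measurable_fun setT F by apply: measurable_fun_xsection.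
transitivity (\int[lebesgue_measure]_x F (thead a + x)%R).
  apply: eq_integral => x _.
  rewrite /F -(IH [tuple of behead a]); last exact: measurable_xsection.
  congr (lebesgue_tuple R n _); apply/seteqP; split=> t;
    rewrite /xsection /B /= !inE /=;
    (suff -> : tadd a (tuple_of_pair (x, t)) =
      tuple_of_pair ((thead a + x)%R, tadd [tuple of behead a] t) by []);
    apply: eq_from_tnth => i; rewrite tnth_mktuple;
    case: (unliftP ord0 i) => [j ->|->]; rewrite ?tnth0 // !tnthS tnth_mktuple tnth_behead;
    by congr (tnth a _ + _)%R; apply: val_inj; rewrite /= inordK // ltnS ltn_ord.
have mf : measurable_fun setT ((fun x : mR => thead a + x)%R : mR -> mR).
  exact: measurable_funD.
rewrite -[LHS](@ge0_integral_pushforward _ _ _ _ R _ mf lebesgue_measure setT F) //.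
  by apply: eq_measure_integral => C mC _; exact: lebesgue_measure_addl.
Qed.

End translation.

(** * Uniqueness of translation-invariant measures up to a factor *)

Section haar.
Local Open Scope ereal_scope.
Context (R : realType) (n : nat).
Local Notation mR := (measurableTypeR R).
Variables mu nu : {sigma_finite_measure set (n.-tuple mR) -> \bar R}.
Hypothesis tmu : translation_invariant mu.
Hypothesis tnu : translation_invariant nu.

(** Fubini on the set of pairs with x + y in [A] and y in [B]. Integrating over x first, invariance
    of [mu] gives the left side. Integrating over y first, invariance of [nu] allows y to be
    replaced by y - x, which leads to the pairs with y in [A] and y - x in [B]; their sections in x
    are translates of the reflected [B]. A set [B] with [nu B = 1] then exhibits [mu] as a multiple
    of [nu]. *)
Lemma prod_invariant_measure (A B : set (n.-tuple mR)) :
  measurable A -> measurable B ->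
  mu A * nu B = nu A * mu (@topp R n @^-1` B).
Proof.
move=> mA mB.
pose E := [set p : n.-tuple mR * n.-tuple mR | A (tadd p.1 p.2) /\ B p.2].
pose E' := [set p : n.-tuple mR * n.-tuple mR | A p.2 /\ B (tadd (topp p.1) p.2)].
have mE : measurable E.
  apply: measurableI.
    by apply: (measurable_preimage _ mA); exact: measurable_tadd.
  exact: (measurable_preimage _ mB).
have mE' : measurable E'.
  apply: measurableI; first exact: (measurable_preimage _ mA).
  apply: (measurable_preimage _ mB); apply: measurable_tadd => //.
  exact: measurable_topp.
have swap (X : set (n.-tuple mR * n.-tuple mR)) : measurable X ->
    (mu \x nu) X = (mu \x^ nu) X.
  move=> mX; apply: product_measure_unique => // C D mC mD.
  exact: product_measure2E.
have int1 (m : {sigma_finite_measure set (n.-tuple mR) -> \bar R}) (k : \bar R)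
   (C : set (n.-tuple mR)) : measurable C -> 0 <= k ->
   \int[m]_x (k * (\1_C x)%:E) = k * m C.
  move=> mC k0; rewrite ge0_integralZl ?integral_indic ?setIT //.
  exact: measurableT_comp.
transitivity ((mu \x^ nu) E).
  rewrite -int1 ?measure_ge0 //; apply: eq_integral => y _ /=.
  rewrite indicE; have [yB|yB] := boolP (y \in B).
    rewrite mule1 -(tmu y) //; congr (mu _).
    apply/seteqP; split=> x; rewrite /ysection /E /= inE /=.
      split; last by rewrite -inE.
      by congr A : H; apply: eq_from_tnth => i; rewrite !tnth_mktuple addrC.
    case=> + _; congr A; by apply: eq_from_tnth => i; rewrite !tnth_mktuple addrC.
  rewrite mule0 (_ : ysection E y = set0) ?measure0 //.
  apply/seteqP; split=> x //; rewrite /ysection /E /= inE /= => -[_].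
  by move/mem_set; apply/negP.
rewrite -swap //; transitivity ((mu \x nu) E').
  apply: eq_integral => x _ /=.
  rewrite -[RHS](tnu x); last exact: measurable_xsection.
  congr (nu _); apply/seteqP; split=> y; rewrite /xsection /E /E' /= !inE /=.
    move=> [Axy By]; split=> //; congr B : By.
    by apply: eq_from_tnth => i; rewrite !tnth_mktuple addKr.
  move=> [Axy By]; split=> //; congr B : By.
  by apply: eq_from_tnth => i; rewrite !tnth_mktuple addKr.
rewrite swap // [RHS]muleC -int1 ?measure_ge0 //.
apply: eq_integral => y _ /=.
rewrite indicE; have [yA|yA] := boolP (y \in A).
  rewrite mule1 -[RHS](tmu (topp y)); last first.
    by apply: (measurable_preimage _ mB); exact: measurable_topp.
  congr (mu _); apply/seteqP; split=> x; rewrite /ysection /E' /= inE /=.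
    move=> [_]; congr B; apply: eq_from_tnth => i; rewrite !tnth_mktuple.
    by rewrite opprD opprK addrC.
  move=> Bx; split; first by rewrite -inE.
  congr B : Bx; apply: eq_from_tnth => i; rewrite !tnth_mktuple.
  by rewrite opprD opprK addrC.
rewrite mule0 (_ : ysection E' y = set0) ?measure0 //.
apply/seteqP; split=> x //; rewrite /ysection /E' /= inE /= => -[].
by move/mem_set => Ay; move: yA; rewrite Ay.
Qed.

End haar.


(** * Volume and integrals on row vectors *)

(* 'rV[R]_n carries no sigma-algebra here: measurability of subsets of, and functions
   on, row vectors is measurability after composition with [rowt]. *)
Section measurable_rv.
Context (R : realType).
Local Notation mR := (measurableTypeR R).

Definition rowt n (t : n.-tuple mR) : 'rV[R]_n := \row_i tnth t i.
Definition tupr n (x : 'rV[R]_n) : n.-tuple mR := [tuple (x 0 i : mR) | i < n].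

Lemma rowtK n : cancel (@rowt n) (@tupr n).
Proof. by move=> t; apply: eq_from_tnth => i; rewrite tnth_mktuple mxE. Qed.

Lemma tuprK n : cancel (@tupr n) (@rowt n).
Proof. by move=> x; apply/rowP => i; rewrite mxE tnth_mktuple. Qed.

Definition rvset n (A : set 'rV[R]_n) := measurable (@rowt n @^-1` A).
Definition rvfun n (f : 'rV[R]_n -> R) := measurable_fun setT (f \o @rowt n).
Definition rvmap n m (g : 'rV[R]_n -> 'rV[R]_m) := forall j, rvfun (fun x => g x 0 j).

Section fixed_dim.
Variable n : nat.
Implicit Types (A B : set 'rV[R]_n) (f g : 'rV[R]_n -> R).

Lemma rvsetI A B : rvset A -> rvset B -> rvset (A `&` B).
Proof. by move=> mA mB; apply: measurableI. Qed.

Lemma rvsetU A B : rvset A -> rvset B -> rvset (A `|` B).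
Proof. by move=> mA mB; apply: measurableU. Qed.

Lemma rvset_all (I : finType) (F : I -> set 'rV[R]_n) :
  (forall i, rvset (F i)) -> rvset [set x | forall i, F i x].
Proof.
move=> mF; rewrite /rvset (_ : _ @^-1` _ =
   \bigcap_(i in [set: I]) (@rowt n @^-1` F i)).
  by apply: fin_bigcap_measurable => // i _; exact: mF.
by apply/seteqP; split=> t /= H i => [_|]; exact: H.
Qed.

Lemma rvset_impl (b : bool) A : rvset A -> rvset [set x | b -> A x].
Proof.
move=> mA; case: b.
  by rewrite [X in rvset X](_ : _ = A) //; apply/seteqP; split=> x /=; [exact|move=> Ax _].
by rewrite [X in rvset X](_ : _ = setT); [exact: measurableT|apply/seteqP; split].
Qed.

Lemma rvfun_cst c : @rvfun n (fun=> c).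
Proof. exact: measurable_cst. Qed.

Lemma rvfun_coord i : @rvfun n (fun x => x 0 i).
Proof.
rewrite /rvfun (_ : _ \o _ = (fun t : n.-tuple mR => tnth t i)).
  exact: measurable_tnth.
by apply/funext => t /=; rewrite mxE.
Qed.

Lemma rvfunD f g : rvfun f -> rvfun g -> rvfun (fun x => f x + g x).
Proof. by move=> mf mg; apply: (measurable_funD mf mg). Qed.

Lemma rvfunB f g : rvfun f -> rvfun g -> rvfun (fun x => f x - g x).
Proof. by move=> mf mg; apply: (measurable_funB mf mg). Qed.

Lemma rvfunM f g : rvfun f -> rvfun g -> rvfun (fun x => f x * g x).
Proof. by move=> mf mg; apply: (measurable_funM mf mg). Qed.

Lemma rvfun_sum (I : Type) (r : seq I) (F : I -> 'rV[R]_n -> R) :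
  (forall i, rvfun (F i)) -> rvfun (fun x => \sum_(i <- r) F i x).
Proof.
move=> mF; elim: r => [|i r IH].
  by rewrite (_ : (fun _ => _) = (fun=> 0)); [exact: rvfun_cst|apply/funext => x; rewrite big_nil].
rewrite (_ : (fun _ => _) = (fun x => F i x + \sum_(j <- r) F j x)).
  exact: rvfunD.
by apply/funext => x; rewrite big_cons.
Qed.

Lemma rvfun_sqrt f : rvfun f -> rvfun (fun x => Num.sqrt (f x)).
Proof.
move=> mf; apply: (@measurableT_comp _ _ _ _ _ _ (@Num.sqrt R : mR -> mR)) => //.
by apply: continuous_measurable_fun; exact: sqrt_continuous.
Qed.

Lemma rvset_le f g : rvfun f -> rvfun g -> rvset [set x | f x <= g x].
Proof.
move=> mf mg; have : measurable ([set: n.-tuple mR] `&` (fun t => _) @^-1` [set true]) :=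
  measurable_fun_ler mf mg measurableT (Logic.I : measurable [set true]).
by rewrite setTI; congr measurable; apply/seteqP; split=> t.
Qed.

Lemma rvset_lt f g : rvfun f -> rvfun g -> rvset [set x | f x < g x].
Proof.
move=> mf mg; have : measurable ([set: n.-tuple mR] `&` (fun t => _) @^-1` [set true]) :=
  measurable_fun_ltr mf mg measurableT (Logic.I : measurable [set true]).
by rewrite setTI; congr measurable; apply/seteqP; split=> t.
Qed.

Lemma rvfun_inner (m : nat) (g h : 'rV[R]_n -> 'rV[R]_m) :
  rvmap g -> rvmap h -> rvfun (fun x => inner (g x) (h x)).
Proof. by move=> mg mh; apply: rvfun_sum => i; apply: rvfunM. Qed.

Lemma rvmap_cst (m : nat) (c : 'rV[R]_m) : @rvmap n m (fun=> c).
Proof. by move=> j; exact: rvfun_cst. Qed.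

Lemma rvmap_id : @rvmap n n id.
Proof. by move=> j; exact: rvfun_coord. Qed.

Lemma rvmapD (m : nat) (g h : 'rV[R]_n -> 'rV[R]_m) :
  rvmap g -> rvmap h -> rvmap (fun x => g x + h x).
Proof.
move=> mg mh j; rewrite (_ : (fun _ => _) = (fun x => g x 0 j + h x 0 j)).
  exact: rvfunD.
by apply/funext => x; rewrite mxE.
Qed.


Lemma rvmap_mul (m k : nat) (g : 'rV[R]_n -> 'rV[R]_m) (M : 'M[R]_(m, k)) :
  rvmap g -> rvmap (fun x => g x *m M).
Proof.
move=> mg j; rewrite (_ : (fun _ => _) = (fun x => \sum_i g x 0 i * M i j)).
  by apply: rvfun_sum => i; apply: rvfunM => //; exact: rvfun_cst.
by apply/funext => x; rewrite mxE.
Qed.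

Lemma rvmap_comp_meas (m : nat) (g : 'rV[R]_n -> 'rV[R]_m) : rvmap g ->
  measurable_fun setT (fun t => tupr (g (rowt t))).
Proof.
move=> mg; apply/measurable_fun_tnthP => i.
have := mg i; rewrite /rvfun; congr (measurable_fun _ _); apply/funext => t /=.
by rewrite tnth_mktuple.
Qed.

Lemma rvset_preim (m : nat) (g : 'rV[R]_n -> 'rV[R]_m) (A : set 'rV[R]_m) :
  rvmap g -> rvset A -> rvset [set x | A (g x)].
Proof.
move=> mg mA; have := measurable_preimage (rvmap_comp_meas mg) mA.
by congr measurable; apply/seteqP; split=> t /=; rewrite tuprK.
Qed.


End fixed_dim.
End measurable_rv.

Section volume_theory.
Context (R : realType) (n : nat).
Local Notation mR := (measurableTypeR R).
Implicit Types (A B C : set 'rV[R]_n).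

Definition bounded_rv A := exists K : R, forall x i, A x -> `|x 0 i| <= K.
Definition rvbms A := rvset A /\ bounded_rv A.
Definition vol A : R := fine (volume A).

Lemma volume_ge0 A : (0 <= volume A)%E.
Proof. exact: measure_ge0. Qed.

Lemma le_volume A B : rvset A -> rvset B -> A `<=` B -> (volume A <= volume B)%E.
Proof. by move=> mA mB AB; apply: le_measure; rewrite ?inE // => t; exact: AB. Qed.

Definition box (a b : 'I_n -> R) : set 'rV[R]_n := [set x | forall i, a i <= x 0 i <= b i].

Lemma rvset_box a b : rvset (box a b).
Proof.
apply: rvset_all => i.
rewrite [X in rvset X](_ : _ = [set x : 'rV[R]_n | a i <= x 0 i] `&` [set x | x 0 i <= b i]).
  apply: rvsetI; apply: rvset_le; by [exact: rvfun_cst|exact: rvfun_coord].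
by apply/seteqP; split=> x /=; [move/andP|move=> []; move=> *; apply/andP].
Qed.

Lemma volume_box a b : (forall i, a i <= b i) ->
  volume (box a b) = (\prod_(i < n) (b i - a i))%:E.
Proof.
move=> ab; rewrite /volume -[X in lebesgue_tuple _ _ X]/(@rowt R n @^-1` box a b).
rewrite (_ : _ @^-1` _ = [set t : n.-tuple mR | forall i, (`[a i, b i]%classic : set mR) (tnth t i)]);
  last first.
  by apply/seteqP; split=> t /= H i; have := H i; rewrite ?mxE /= in_itv /=.
have /= -> := @lebesgue_tuple_box R n (fun i => `[a i, b i]%classic)
  (fun i => measurable_itv _).
rewrite (eq_bigr (fun i => (b i - a i)%:E)); last first.
  move=> i _; rewrite lebesgue_measure_itv /= lte_fin.
  by case: ltgtP (ab i) => // ->; rewrite subrr.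
by elim/big_rec2: _ => // i x y _ ->.
Qed.

Lemma bounded_sub A B : A `<=` B -> bounded_rv B -> bounded_rv A.
Proof. by move=> AB [K HK]; exists K => x i /AB; exact: HK. Qed.

Lemma volume_fin A : rvbms A -> volume A \is a fin_num.
Proof.
move=> [mA [K HK]]; rewrite ge0_fin_numE ?volume_ge0 //.
apply: (@le_lt_trans _ _ (volume (box (fun=> - `|K|) (fun=> `|K|)))).
  apply: le_volume => //; first exact: rvset_box.
  move=> x Ax i; rewrite -ler_norml.
  by apply: le_trans (HK _ i Ax) _; exact: ler_norm.
by rewrite volume_box ?ltry // => i; rewrite ge0_cp ?normr_ge0.
Qed.

Lemma volE A : rvbms A -> volume A = (vol A)%:E.
Proof. by move=> bA; rewrite /vol fineK // volume_fin. Qed.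

Lemma vol_ge0 A : 0 <= vol A.
Proof. by apply: fine_ge0; exact: volume_ge0. Qed.

Lemma le_vol A B : rvbms A -> rvbms B -> A `<=` B -> vol A <= vol B.
Proof.
move=> bA bB AB; rewrite -lee_fin -!volE //.
by apply: le_volume => //; [case: bA|case: bB].
Qed.

Lemma rvbmsU A B : rvbms A -> rvbms B -> rvbms (A `|` B).
Proof.
move=> [mA [K HK]] [mB [L HL]]; split; first exact: rvsetU.
by exists (Num.max K L) => x i [/HK|/HL] H; rewrite le_max H ?orbT.
Qed.

Lemma rvbmsI A B : rvbms A -> rvset B -> rvbms (A `&` B).
Proof. by move=> [mA bA] mB; split; [exact: rvsetI|apply: bounded_sub bA => x []]. Qed.


Lemma vol0 : vol set0 = 0.
Proof. by rewrite /vol /volume -[X in lebesgue_tuple _ _ X]/set0 measure0. Qed.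

Lemma vol_setU A B : rvbms A -> rvbms B -> A `&` B = set0 ->
  vol (A `|` B) = vol A + vol B.
Proof.
move=> bA bB AB0; apply: EFin_inj; rewrite EFinD -!volE //; last exact: rvbmsU.
rewrite /volume -[X in lebesgue_tuple _ _ X]/((@rowt R n @^-1` A) `|` (@rowt R n @^-1` B)).
rewrite measureU //; [by case: bA|by case: bB|].
by rewrite -preimage_setI AB0 preimage_set0.
Qed.

Lemma vol_setU_le A B : rvbms A -> rvbms B -> vol (A `|` B) <= vol A + vol B.
Proof.
move=> bA bB; have bD : rvbms (B `\` A).
  split; last by apply: bounded_sub bB.2 => x [].
  by apply: measurableD; [exact: bB.1|exact: bA.1].
rewrite (_ : A `|` B = A `|` (B `\` A)); last first.
  by apply/seteqP; split=> x /=; [case: (pselect (A x)); tauto|tauto].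
rewrite vol_setU //; last by apply/seteqP; split=> x //= -[? []].
by rewrite lerD2l; apply: le_vol => // x [].
Qed.

Lemma vol_le_sum (I : eqType) (r : seq I) (F : I -> set 'rV[R]_n) A :
  (forall i, rvbms (F i)) -> rvbms A ->
  (forall x, A x -> exists2 i, i \in r & F i x) -> vol A <= \sum_(i <- r) vol (F i).
Proof.
move=> bF; elim: r A => [|i r IH] A bA HA.
  rewrite big_nil (_ : A = set0) ?vol0 //.
  by apply/seteqP; split=> x // /HA[].
rewrite big_cons.
have bD : rvbms (A `\` F i).
  split; last by apply: bounded_sub bA.2 => x [].
  by apply: measurableD; [exact: bA.1|exact: (bF i).1].
apply: (@le_trans _ _ (vol (F i `|` (A `\` F i)))).
  apply: le_vol => //; first exact: rvbmsU.
  by move=> x Ax /=; case: (pselect (F i x)); [left|right].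
apply: le_trans (vol_setU_le _ _) _ => //; rewrite lerD2l; apply: IH => //.
move=> x [/HA[j]]; rewrite inE => /predU1P[->//|jr] Fj _; by exists j.
Qed.

Lemma vol_sum_le (I : eqType) (r : seq I) (F : I -> set 'rV[R]_n) A :
  (forall i, i \in r -> rvbms (F i)) -> rvbms A -> uniq r ->
  (forall i, i \in r -> F i `<=` A) ->
  (forall i j x, i \in r -> j \in r -> F i x -> F j x -> i = j) ->
  \sum_(i <- r) vol (F i) <= vol A.
Proof.
elim: r A => [|i r IH] A bF bA /=; first by rewrite big_nil vol_ge0.
move=> /andP[ir ur] FA Fdis; rewrite big_cons.
have bFi : rvbms (F i) by apply: bF; rewrite mem_head.
have bD : rvbms (A `\` F i).
  split; last by apply: bounded_sub bA.2 => x [].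
  by apply: measurableD; [exact: bA.1|exact: bFi.1].
apply: (@le_trans _ _ (vol (F i) + vol (A `\` F i))).
  rewrite lerD2l; apply: IH => //.
  - by move=> j jr; apply: bF; rewrite inE jr orbT.
  - move=> j jr x Fx; split; first by apply: FA Fx; rewrite inE jr orbT.
    move=> Fix; move: ir; rewrite (Fdis i j x) ?mem_head ?jr //.
    by rewrite inE jr orbT.
  by move=> j k x jr kr; apply: Fdis; rewrite inE ?jr ?kr orbT.
rewrite -vol_setU //; last by apply/seteqP; split=> x //= -[? []].
apply: le_vol => //; first exact: rvbmsU.
by move=> x [Fx|[]//]; apply: FA Fx; rewrite mem_head.
Qed.

Lemma vol_box a b : (forall i, a i <= b i) -> vol (box a b) = \prod_(i < n) (b i - a i).
Proof. by move=> ab; rewrite /vol volume_box. Qed.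

Lemma rvbms_box a b : rvbms (box a b).
Proof.
split; first exact: rvset_box.
exists (\sum_i (`|a i| + `|b i|)) => x i Hx; have /andP[h1 h2] := Hx i.
apply: (@le_trans _ _ (`|a i| + `|b i|)).
  have := ler_norm (b i); have := ler_norm (- a i); rewrite normrN ler_norml.
  have := normr_ge0 (a i); have := normr_ge0 (b i).
  by move=> *; apply/andP; split; lra.
rewrite (bigD1 i) //= lerDl; apply: sumr_ge0 => j _.
by rewrite addr_ge0.
Qed.

Lemma vol_gt0 A a b : rvbms A -> (forall i, a i < b i) -> box a b `<=` A -> 0 < vol A.
Proof.
move=> bA ab sA; apply: lt_le_trans (le_vol (rvbms_box _ _) bA sA).
rewrite vol_box => [|i]; last exact: ltW.
by apply: prodr_gt0 => i _; rewrite subr_gt0.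
Qed.

End volume_theory.


(** * Linear changes of variables *)

Section linear_pushforward.
Local Open Scope ereal_scope.
Context (R : realType) (n : nat).
Local Notation mR := (measurableTypeR R).
Variable M : 'M[R]_n.
Hypothesis uM : M \in unitmx.

Definition tmul (N : 'M[R]_n) (t : n.-tuple mR) : n.-tuple mR := tupr (rowt t *m N)%R.

Lemma measurable_tmul N : measurable_fun setT (tmul N).
Proof. exact: (rvmap_comp_meas (rvmap_mul N (@rvmap_id R n))). Qed.

Lemma rowt_tmul N t : rowt (tmul N t) = (rowt t *m N)%R.
Proof. by rewrite /tmul tuprK. Qed.

Lemma rowt_tadd (a t : n.-tuple mR) : rowt (tadd a t) = (rowt a + rowt t)%R.
Proof. by apply/rowP => i; rewrite !mxE tnth_mktuple. Qed.

Definition linpush : set (n.-tuple mR) -> \bar R :=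
  pushforward (lebesgue_tuple R n) (tmul M).

Let linpush0 : linpush set0 = 0.
Proof. by rewrite /linpush /pushforward preimage_set0 measure0. Qed.

Let linpush_ge0 A : 0 <= linpush A.
Proof. by rewrite /linpush /pushforward; exact: measure_ge0. Qed.

Let linpush_sigma_additive : semi_sigma_additive linpush.
Proof.
move=> F mF tF mUF; rewrite /linpush /pushforward preimage_bigcup.
apply: measure_semi_sigma_additive.
- by move=> k; apply: (measurable_preimage _ (mF k)); exact: measurable_tmul.
- apply/trivIsetP => /= i j _ _ ij; rewrite -preimage_setI.
  by move/trivIsetP : tF => /(_ _ _ _ _ ij) ->//; rewrite preimage_set0.
- by rewrite -preimage_bigcup; apply: (measurable_preimage _ mUF); exact: measurable_tmul.
Qed.

HB.instance Definition _ := isMeasure.Build _ _ _ linpush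
  linpush0 linpush_ge0 linpush_sigma_additive.

Let linpush_sigma_finite : sigma_finite setT linpush.
Proof.
have /sigma_finiteP[F [TF ndF Foo]] := sigma_finiteT (lebesgue_tuple R n).
exists (fun k => tmul (invmx M) @^-1` F k).
  by rewrite -preimage_bigcup -TF preimage_setT.
move=> k; have [mF Fk] := Foo k; split.
  by apply: (measurable_preimage _ mF); exact: measurable_tmul.
rewrite /linpush /pushforward -comp_preimage (_ : _ \o _ = id) ?preimage_id //.
by apply/funext => t /=; rewrite /tmul tuprK mulmxK // rowtK.
Qed.

HB.instance Definition _ := Measure_isSigmaFinite.Build _ _ _ linpush
  linpush_sigma_finite.

Lemma linpush_translation : translation_invariant linpush.
Proof.
move=> a A mA; rewrite /linpush /pushforward.
rewrite -[RHS](lebesgue_tuple_translation (tmul (invmx M) a)); last first.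
  by apply: (measurable_preimage _ mA); exact: measurable_tmul.
have E t : tadd a (tmul M t) = tmul M (tadd (tmul (invmx M) a) t).
  apply: (can_inj (@rowtK R n)).
  by rewrite rowt_tmul !rowt_tadd !rowt_tmul mulmxDl mulmxKV.
by congr (lebesgue_tuple R n _); apply/seteqP; split=> t /=; rewrite E.
Qed.

End linear_pushforward.

Section change_of_variables.
Context (R : realType) (n : nat).
Implicit Types (A B : set 'rV[R]_n).

Lemma rvset_mul A (M : 'M[R]_n) : rvset A -> rvset [set x | A (x *m M)].
Proof. by move=> mA; apply: rvset_preim mA; apply: rvmap_mul; exact: rvmap_id. Qed.

Lemma rvbms_mul A (M : 'M[R]_n) : M \in unitmx -> rvbms A -> rvbms [set x | A (x *m M)].
Proof.
move=> uM [mA [K HK]]; split; first exact: rvset_mul.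
exists (\sum_i \sum_j (K * `|invmx M j i|)) => x i /= Ax.
rewrite -(mulmxK uM x) mxE; apply: le_trans (ler_norm_sum _ _ _) _.
apply: (@le_trans _ _ (\sum_j (K * `|invmx M j i|))).
  by apply: ler_sum => j _; rewrite normrM ler_wpM2r // HK.
rewrite [leRHS](bigD1 i) //= lerDl; apply: sumr_ge0 => k _; apply: sumr_ge0 => j _.
by rewrite mulr_ge0 // (le_trans _ (HK _ j Ax)).
Qed.

(** The factor [k] is the inverse of |det M|, but it stays abstract: each use evaluates or compares
    it on one convenient set, such as a box, a ball or a pyramid. The reflected cube [B'] comes from
    the reflection in [prod_invariant_measure]. *)
Lemma vol_lin (M : 'M[R]_n) : M \in unitmx ->
  exists2 k : R, 0 <= k & forall A, rvbms A -> vol [set x | A (x *m M)] = k * vol A.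
Proof.
move=> uM.
pose B : set 'rV[R]_n := box (fun=> 0) (fun=> 1).
have bB : rvbms B by exact: rvbms_box.
pose B' : set 'rV[R]_n := [set x | B (- x)].
have bB' : rvbms B'.
  split; last first.
    exists 1 => x i /= Bx; have := Bx i; rewrite mxE => /andP[h1 h2].
    by rewrite ler_norml; apply/andP; split; lra.
  apply: (rvset_preim _ bB.1) => j.
  rewrite (_ : (fun _ => _) = (fun x : 'rV[R]_n => 0 - x 0 j)).
    by apply: rvfunB; [exact: rvfun_cst|exact: rvfun_coord].
  by apply/funext => x; rewrite mxE sub0r.
exists (vol [set x | B' (x *m M)]); first exact: vol_ge0.
move=> A bA; apply: EFin_inj; rewrite EFinM -!volE //; try exact: rvbms_mul.
have linE C : linpush M (@rowt R n @^-1` C) = volume [set x | C (x *m M)].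
  rewrite /linpush /pushforward /volume; congr (lebesgue_tuple R n _).
  by apply/seteqP; split=> t /=; rewrite /tmul tuprK.
have := @prod_invariant_measure R n (linpush M) (lebesgue_tuple R n) (linpush_translation uM)
  (@lebesgue_tuple_translation R n) _ _ bA.1 bB.1.
move=> /(_ uM) /=; rewrite linE.
have -> : topp (n:=n) @^-1` (@rowt R n @^-1` B) = @rowt R n @^-1` B'.
  apply/seteqP; split=> t /=; congr B; apply/rowP => i; by rewrite !mxE tnth_mktuple.
rewrite linE -/(volume B) -/(volume A) (_ : volume B = 1%E) ?mule1 => [->|].
  by rewrite muleC.
by rewrite volume_box // big1 // => i _; rewrite subr0.
Qed.

Lemma rvbms_trans A (a : 'rV[R]_n) : rvbms A -> rvbms [set x | A (a + x)].
Proof.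
move=> [mA [K HK]]; split.
  by apply: rvset_preim mA; apply: rvmapD; [exact: rvmap_cst|exact: rvmap_id].
exists (\sum_i (K + `|a 0 i|)) => x i /= Ax.
have H j : `|x 0 j| <= K + `|a 0 j|.
  have := HK _ j Ax; rewrite mxE => h.
  have := ler_normB (a 0 j + x 0 j) (a 0 j).
  by rewrite addrAC subrr add0r => h'; apply: le_trans h' _; rewrite lerD2r.
apply: le_trans (H i) _; rewrite (bigD1 i) //= lerDl; apply: sumr_ge0 => j _.
exact: le_trans (H j).
Qed.

Lemma vol_trans A (a : 'rV[R]_n) : rvbms A -> vol [set x | A (a + x)] = vol A.
Proof.
move=> bA; rewrite /vol; congr fine; rewrite /volume.
rewrite -[RHS](@lebesgue_tuple_translation R n (tupr a)); last exact: bA.1.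
congr (lebesgue_tuple R n _); apply/seteqP; split=> t /=; congr A;
  by apply/rowP => i; rewrite !mxE !tnth_mktuple.
Qed.

Lemma rvbms_scale A (t : R) : 0 < t -> rvbms A -> rvbms [set x | A (t *: x)].
Proof.
move=> t0 bA; have : rvbms [set x | A (x *m t%:M)].
  by apply: rvbms_mul => //; rewrite unitmxE det_scalar unitfE expf_neq0 // gt_eqF.
by congr rvbms; apply/seteqP; split=> x /=; rewrite mul_mx_scalar.
Qed.

Lemma vol_scale A (t : R) : 0 < t -> rvbms A -> vol [set x | A (t *: x)] = t^-1 ^+ n * vol A.
Proof.
move=> t0 bA; have uM : (t%:M : 'M[R]_n) \in unitmx.
  by rewrite unitmxE det_scalar unitfE expf_neq0 // gt_eqF.
have [k k0 Hk] := vol_lin uM.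
have E C : [set x | C (x *m t%:M)] = [set x : 'rV[R]_n | C (t *: x)].
  by apply/seteqP; split=> x /=; rewrite mul_mx_scalar.
rewrite -E Hk //; congr (_ * _).
have := Hk _ (rvbms_box (fun=> 0) (fun=> 1)).
rewrite E vol_box // [X in _ * X]big1 => [|i _]; last by rewrite subr0.
rewrite mulr1 => <-.
rewrite [X in vol X](_ : _ = box (fun=> 0) (fun=> t^-1)).
  rewrite vol_box => [|i]; last by rewrite invr_ge0 ltW.
  by rewrite subr0 prodr_const card_ord.
apply/seteqP; split=> x /= H i; have /andP[h1 h2] := H i.
  move: h1 h2; rewrite mxE pmulr_rge0 // => -> /=.
  by rewrite -ler_pdivlMl // mulr1.
rewrite mxE pmulr_rge0 // h1 /=.
by rewrite -ler_pdivlMl // mulr1.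
Qed.

End change_of_variables.


(** * Integrals over bounded measurable sets *)

Section integral_rv.
Context (R : realType) (n : nat).
Local Notation mR := (measurableTypeR R).
Local Notation la := (lebesgue_tuple R n).
Implicit Types (U A B : set 'rV[R]_n) (f g : 'rV[R]_n -> R).

Definition rvint U g : R := \int[la]_(t in @rowt R n @^-1` U) g (rowt t).

Definition rvbfun U g := rvfun g /\ exists K, forall x, U x -> `|g x| <= K.

Lemma rvbfun_integrable U g : rvbms U -> rvbfun U g ->
  la.-integrable (@rowt R n @^-1` U) (EFin \o (g \o @rowt R n)).
Proof.
move=> bU [mg [K HK]]; apply: measurable_bounded_integrable.
- exact: bU.1.
- have := volume_fin bU; rewrite ge0_fin_numE ?volume_ge0 //.
- exact: measurable_funTS mg.
- exists K; split; first exact: num_real.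
  by move=> x Kx t Ut /=; apply: le_trans (HK _ Ut) (ltW Kx).
Qed.

Lemma rvbfunD U f g : rvbfun U f -> rvbfun U g -> rvbfun U (fun x => f x + g x).
Proof.
move=> [mf [K HK]] [mg [L HL]]; split; first exact: rvfunD.
by exists (K + L) => x Ux; apply: le_trans (ler_normD _ _) _; rewrite lerD ?HK ?HL.
Qed.

Lemma rvbfunM U f g : rvbfun U f -> rvbfun U g -> rvbfun U (fun x => f x * g x).
Proof.
move=> [mf [K HK]] [mg [L HL]]; split; first exact: rvfunM.
by exists (K * L) => x Ux; rewrite normrM ler_pM ?HK ?HL.
Qed.

Lemma rvbfun_cst U c : rvbfun U (fun=> c).
Proof. by split; [exact: rvfun_cst|exists `|c|]. Qed.

Lemma rvbfun_coord U i : bounded_rv U -> rvbfun U (fun x => x 0 i).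
Proof. by move=> [K HK]; split; [exact: rvfun_coord|exists K => x /HK]. Qed.

Lemma rvbfun_sum U (I : Type) (r : seq I) (F : I -> 'rV[R]_n -> R) :
  (forall i, rvbfun U (F i)) -> rvbfun U (fun x => \sum_(i <- r) F i x).
Proof.
move=> bF; elim: r => [|i r IH].
  rewrite (_ : (fun _ => _) = (fun=> 0)); first exact: rvbfun_cst.
  by apply/funext => x; rewrite big_nil.
rewrite (_ : (fun _ => _) = (fun x => F i x + \sum_(j <- r) F j x)).
  exact: rvbfunD.
by apply/funext => x; rewrite big_cons.
Qed.

Lemma rvbfun_sub U A g : A `<=` U -> rvbfun U g -> rvbfun A g.
Proof. by move=> AU [mg [K HK]]; split=> //; exists K => x /AU/HK. Qed.

Lemma rvint_cst U c : rvbms U -> rvint U (fun=> c) = c * vol U.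
Proof. by move=> bU; rewrite /rvint Rintegral_cst //; exact: bU.1. Qed.

Lemma rvintD U f g : rvbms U -> rvbfun U f -> rvbfun U g ->
  rvint U (fun x => f x + g x) = rvint U f + rvint U g.
Proof.
move=> bU bf bg; rewrite /rvint; apply: RintegralD; first exact: bU.1.
  exact: rvbfun_integrable.
exact: rvbfun_integrable.
Qed.

Lemma rvintZ U c g : rvbms U -> rvbfun U g ->
  rvint U (fun x => c * g x) = c * rvint U g.
Proof.
move=> bU bg; rewrite /rvint; apply: RintegralZl; first exact: bU.1.
exact: rvbfun_integrable.
Qed.

Lemma rvint_sum U (I : Type) (r : seq I) (F : I -> 'rV[R]_n -> R) : rvbms U ->
  (forall i, rvbfun U (F i)) ->
  rvint U (fun x => \sum_(i <- r) F i x) = \sum_(i <- r) rvint U (F i).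
Proof.
move=> bU bF; elim: r => [|i r IH].
  rewrite big_nil (_ : (fun _ => _) = (fun=> 0)) ?rvint_cst ?mul0r //.
  by apply/funext => x; rewrite big_nil.
rewrite big_cons -IH -rvintD //; last exact: rvbfun_sum.
by congr rvint; apply/funext => x; rewrite big_cons.
Qed.

Lemma le_rvint U f g : rvbms U -> rvbfun U f -> rvbfun U g ->
  (forall x, U x -> f x <= g x) -> rvint U f <= rvint U g.
Proof.
move=> bU bf bg fg; apply: le_Rintegral; first exact: bU.1.
- exact: rvbfun_integrable.
- exact: rvbfun_integrable.
- by move=> t Ut; exact: fg.
Qed.

Lemma rvint_setU A B g : rvbms A -> rvbms B -> A `&` B = set0 ->
  rvbfun (A `|` B) g -> rvint (A `|` B) g = rvint A g + rvint B g.
Proof.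
move=> bA bB AB0 bg; rewrite /rvint preimage_setU Rintegral_setU //.
- exact: bA.1.
- exact: bB.1.
- by rewrite -preimage_setU; apply: rvbfun_integrable => //; exact: rvbmsU.
- by apply/eqP/seteqP; split=> t // [h1 h2];
  have : (A `&` B) (rowt t) by []; rewrite AB0.
Qed.

Lemma rvint_ge0 U g : (forall x, U x -> 0 <= g x) -> 0 <= rvint U g.
Proof. by move=> g0; apply: Rintegral_ge0 => t; exact: g0. Qed.

Lemma rvint_lin (M : 'M[R]_n) (k : R) U g : M \in unitmx -> 0 <= k ->
  (forall A, rvbms A -> vol [set x | A (x *m M)] = k * vol A) ->
  rvbms U -> rvfun g -> (forall x, U x -> 0 <= g x) ->
  rvint [set x | U (x *m M)] (fun x => g (x *m M)) = k * rvint U g.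
Proof.
move=> uM k0 Hk bU mg g0.
have mU : measurable (@rowt R n @^-1` U) by exact: bU.1.
have mgU : measurable_fun (@rowt R n @^-1` U) (EFin \o (g \o @rowt R n)).
  by apply/measurable_EFinP; exact: measurable_funTS mg.
transitivity (fine (\int[linpush M]_(t in @rowt R n @^-1` U) (g (rowt t))%:E)).
  rewrite /rvint /Rintegral /linpush ge0_integral_pushforward //; last first.
  - by move=> t; rewrite inE => Ut; rewrite /= lee_fin; exact: g0.
  - exact: measurable_tmul.
  congr fine; rewrite (_ : _ @^-1` _ = tmul M @^-1` (@rowt R n @^-1` U)).
    by apply: eq_integral => t _ /=; rewrite rowt_tmul.
  by apply/seteqP; split=> t /=; rewrite rowt_tmul.
(* The two measures are only known to agree on bounded sets, which suffices because every subset of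
   [U] is bounded. *)
transitivity (fine (\int[mscale (NngNum k0) la]_(t in @rowt R n @^-1` U) (g (rowt t))%:E)).
  congr fine; apply: eq_measure_integral => A mA AU.
  pose A' : set 'rV[R]_n := [set x | A (tupr x)].
  have bA' : rvbms A'.
    split; last by apply: bounded_sub bU.2 => x /AU /=; rewrite tuprK.
    by rewrite /rvset (_ : _ @^-1` _ = A) //; apply/seteqP; split=> t; rewrite /A' /= rowtK.
  have EA : A = @rowt R n @^-1` A' by apply/seteqP; split=> t; rewrite /A' /= rowtK.
  transitivity (volume [set x | A' (x *m M)]).
    by [].
  rewrite volE ?Hk //; last exact: rvbms_mul.
  by rewrite EFinM -volE // /mscale /= EA.
have /= -> := ge0_integral_mscale la mU (NngNum k0) mgU
  (fun t Ut => g0 (rowt t) Ut).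
rewrite /= /rvint /Rintegral.
have [E|k_gt0] := eqVneq k 0; first by rewrite E mul0e mul0r.
have : (0 <= \int[la]_(x in @rowt R n @^-1` U) (g (rowt x))%:E)%E.
  by apply: integral_ge0 => t Ut; rewrite lee_fin; exact: g0.
have kp : 0 < k by rewrite lt_neqAle eq_sym k_gt0.
(* [g] may be unbounded; an infinite integral is sent to 0 by [fine] on both sides. *)
case: (integral _ _ _) => [r _|_|] //=.
by rewrite mulr0 gt0_muley ?lte_fin.
Qed.

Lemma rvint_trans (a : 'rV[R]_n) U g :
  rvbms U -> rvfun g -> (forall x, U x -> 0 <= g x) ->
  rvint [set x | U (a + x)] (fun x => g (a + x)) = rvint U g.
Proof.
move=> bU mg g0.
have mU : measurable (@rowt R n @^-1` U) by exact: bU.1.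
have mgU : measurable_fun (@rowt R n @^-1` U) (EFin \o (g \o @rowt R n)).
  by apply/measurable_EFinP; exact: measurable_funTS mg.
have E t : rowt (tadd (tupr a) t) = a + rowt t.
  by rewrite rowt_tadd tuprK.
transitivity (fine (\int[pushforward la (tadd (tupr a))]_(t in @rowt R n @^-1` U) (g (rowt t))%:E)).
  rewrite /rvint /Rintegral ge0_integral_pushforward //; last first.
  - by move=> t; rewrite inE => Ut; rewrite /= lee_fin; exact: g0.
  - by apply: measurable_tadd.
  congr fine; rewrite (_ : _ @^-1` _ = tadd (tupr a) @^-1` (@rowt R n @^-1` U)).
    by apply: eq_integral => t _ /=; rewrite E.
  by apply/seteqP; split=> t /=; rewrite E.
congr fine; apply: eq_measure_integral; first exact: measurable_tadd.
move=> mt A mA AU; exact: (lebesgue_tuple_translation (tupr a) mA).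
Qed.

End integral_rv.

Section cons_rv.
Context (R : realType) (d : nat).
Local Notation mR := (measurableTypeR R).

Definition rvhead (x : 'rV[R]_d.+1) : R := x 0 0.
Definition rvtail (x : 'rV[R]_d.+1) : 'rV[R]_d := \row_j x 0 (lift 0 j).

Definition rvcons (a : R) (u : 'rV[R]_d) : 'rV[R]_d.+1 :=
  \row_i (if unlift 0 i is Some j then u 0 j else a).

Lemma rvcons0 a u : rvcons a u 0 0 = a.
Proof. by rewrite mxE unlift_none. Qed.

Lemma rvconsS a u j : rvcons a u 0 (lift 0 j) = u 0 j.
Proof. by rewrite mxE liftK. Qed.

Lemma rvhead_cons a u : rvhead (rvcons a u) = a.
Proof. exact: rvcons0. Qed.

Lemma rvtail_cons a u : rvtail (rvcons a u) = u.
Proof. by apply/rowP => j; rewrite mxE rvconsS. Qed.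

Lemma rvcons_eta x : rvcons (rvhead x) (rvtail x) = x.
Proof.
apply/rowP => i; case: (unliftP 0 i) => [j ->|->]; first by rewrite rvconsS mxE.
by rewrite rvcons0.
Qed.

Lemma rowt_pair (a : R) (t : d.-tuple mR) :
  rowt (tuple_of_pair (a : mR, t)) = rvcons a (rowt t).
Proof.
apply/rowP => i; case: (unliftP 0 i) => [j ->|->].
  by rewrite rvconsS !mxE tnthS.
by rewrite rvcons0 mxE tnth0.
Qed.

Lemma rvmap_tail : rvmap rvtail.
Proof.
move=> j; rewrite (_ : (fun _ => _) = (fun x : 'rV[R]_d.+1 => x 0 (lift 0 j))).
  exact: rvfun_coord.
by apply/funext => x; rewrite mxE.
Qed.

Lemma rvfun_head : rvfun rvhead.
Proof. exact: rvfun_coord. Qed.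

Lemma rvset_slab (U : set 'rV[R]_d) a b : rvset U ->
  rvset [set x | a <= rvhead x <= b /\ U (rvtail x)].
Proof.
move=> mU; apply: rvsetI; last exact: rvset_preim rvmap_tail mU.
rewrite [X in rvset X](_ : _ = [set x | a <= rvhead x] `&` [set x | rvhead x <= b]).
  by apply: rvsetI; apply: rvset_le; by [exact: rvfun_cst|exact: rvfun_head].
by apply/seteqP; split=> x /=; [move/andP|move=> []; move=> *; apply/andP].
Qed.

Lemma rvbms_slab (U : set 'rV[R]_d) a b : rvbms U ->
  rvbms [set x | a <= rvhead x <= b /\ U (rvtail x)].
Proof.
move=> [mU [K HK]]; split; first exact: rvset_slab.
exists (Num.max K (Num.max `|a| `|b|)) => x i [/andP[h1 h2] Ux].
case: (unliftP 0 i) => [j ->|->].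
  by have := HK _ j Ux; rewrite mxE le_max => ->.
rewrite -/(rvhead x) 2!le_max; have [h|h] := leP 0 (rvhead x).
  by rewrite ger0_norm // (le_trans h2 (ler_norm b)) !orbT.
rewrite ltr0_norm // -(normrN a) (le_trans _ (ler_norm (- a))) ?lerN2 //.
by rewrite orbT.
Qed.

Lemma vol_slab (U : set 'rV[R]_d) a b : rvbms U -> a <= b ->
  vol [set x | a <= rvhead x <= b /\ U (rvtail x)] = (b - a) * vol U.
Proof.
move=> bU ab; apply: EFin_inj; rewrite EFinM -!volE //; last exact: rvbms_slab.
rewrite /volume /= /lebesgue_step /pushforward.
rewrite (_ : _ @^-1` _ = (`[a, b]%classic : set mR) `*` (@rowt R d @^-1` U)).
  rewrite product_measure1E //; last exact: bU.1.
  congr (_ * _)%E; have := lebesgue_measure_itv (R := R) `[a, b]; rewrite /= lte_fin => ->.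
  by case: ltgtP ab => // ->; rewrite subrr.
by apply/seteqP; split=> -[x t]; rewrite /= -/(rowt _) rowt_pair rvhead_cons rvtail_cons in_itv.
Qed.

(* Fubini for the region between the graphs of [s - g] and [s]. *)
Lemma rvint_le_vol (U : set 'rV[R]_d) (E : set 'rV[R]_d.+1) g s :
  rvbms U -> rvbms E -> rvbfun U g ->
  (forall u a, U u -> s - g u <= a <= s -> E (rvcons a u)) ->
  rvint U g <= vol E.
Proof.
move=> bU bE bg HE.
have mE' : measurable ((@tuple_of_pair R d) @^-1` (@rowt R d.+1 @^-1` E)).
  by apply: (measurable_preimage _ bE.1); exact: measurable_tuple_of_pair.
have mU : measurable (@rowt R d @^-1` U) by exact: bU.1.
have fing : (\int[lebesgue_tuple R d]_(t in @rowt R d @^-1` U) (g (rowt t))%:E)%E \is a fin_num.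
  by apply: integrable_fin_num => //; exact: rvbfun_integrable.
rewrite -lee_fin /rvint /Rintegral fineK // -volE //.
rewrite /volume /= /lebesgue_step /pushforward.
(* [lebesgue_step] integrates sections in the tail over the head; the estimate needs the opposite
   order. *)
rewrite (_ : (_ \x _)%E _ = (lebesgue_measure \x^ lebesgue_tuple R d)%E
   ((@tuple_of_pair R d) @^-1` (@rowt R d.+1 @^-1` E))); last first.
  by apply: product_measure_unique => // C D mC mD; exact: product_measure2E.
rewrite /product_measure2.
apply: (@le_trans _ _ (\int[lebesgue_tuple R d]_(t in @rowt R d @^-1` U)
   (lebesgue_measure \o ysection ((@tuple_of_pair R d) @^-1` (@rowt R d.+1 @^-1` E))) t)%E);
     last first.
  apply: ge0_subset_integral => //.
  by apply: measurable_fun_ysection.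
(* [g] may be negative, so its positive part is what is compared with the lengths of the
   sections. *)
rewrite integralE; apply: (@le_trans _ _ (\int[lebesgue_tuple R d]_(t in @rowt R d @^-1` U)
   (fun t => (g (rowt t))%:E)^\+ t)%E).
  by rewrite -[leRHS]adde0 leeD2l // oppe_le0 integral_ge0.
apply: ge0_le_integral => //.
- apply: measurable_funepos; apply/measurable_EFinP.
  exact: measurable_funTS bg.1.
- by apply: measurable_funTS; apply: measurable_fun_ysection.
move=> t Ut; rewrite funeposE /=; have [g0|g0] := leP 0 (g (rowt t)); last first.
  by rewrite (_ : maxe _ _ = 0%E) ?measure_ge0 // max_r // lee_fin ltW.
rewrite max_l ?lee_fin //.
rewrite (_ : (g (rowt t))%:E = lebesgue_measure (`[s - g (rowt t), s]%classic : set mR));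
  last first.
  rewrite lebesgue_measure_itv /= lte_fin ltrBlDr ltrDl.
  by case: ltgtP g0 => // [_|<-] _; rewrite -?EFinB ?opprB ?subrr ?subr0 ?subKr // addrC subrK.
apply: le_measure; rewrite ?inE //; first exact: measurable_ysection.
move=> a /=; rewrite in_itv /ysection /= inE /= rowt_pair => Ha.
exact: HE.
Qed.

End cons_rv.


(** * Second moments of a simplex *)

Lemma expr_1BV_le_half (R : realType) n : (0 < n)%N -> (1 - n%:R^-1 : R) ^+ n <= 1/2.
Proof.
move=> n0; have n0R : 0 < n%:R :> R by rewrite ltr0n.
apply: (@le_trans _ _ (expR (- n%:R^-1) ^+ n)).
  apply: lerXn2r; rewrite ?nnegrE ?expR_ge0 // ?expR_ge1Dx //.
  by rewrite subr_ge0 invf_le1 // ler1n.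
rewrite -expRM_natr mulNr mulVf ?gt_eqF // expRN div1r lef_pV2 ?posrE ?expR_gt0 //.
by have := @expR_ge1Dx R 1; rewrite -natr1.
Qed.

Section simplex.
Context (R : realType) (n : nat).
Implicit Types (t : R) (x u : 'rV[R]_n).

Definition osimplex t : set 'rV[R]_n :=
  [set u | (forall i, 0 < u 0 i) /\ \sum_i u 0 i <= t].

Definition csimplex t : set 'rV[R]_n :=
  [set u | (forall i, 0 <= u 0 i) /\ \sum_i u 0 i <= t].

Lemma rvfun_coordsum : @rvfun R n (fun u => \sum_i u 0 i).
Proof. by apply: rvfun_sum => i; exact: rvfun_coord. Qed.

Lemma osimplex_sub t : osimplex t `<=` csimplex t.
Proof. by move=> u [u0 ut]; split=> // i; exact: ltW. Qed.

Lemma csimplex_coord t u i : csimplex t u -> 0 <= u 0 i <= t.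
Proof.
move=> [u0 ut]; rewrite u0 /=; apply: le_trans ut.
by rewrite (bigD1 i) //= lerDl; apply: sumr_ge0.
Qed.

Lemma rvbms_csimplex t : rvbms (csimplex t).
Proof.
split.
  apply: rvsetI; last exact: (rvset_le rvfun_coordsum (rvfun_cst _)).
  by apply: rvset_all => i; exact: (rvset_le (rvfun_cst _) (rvfun_coord _)).
exists t => u i /(@csimplex_coord _ _ i)/andP[h1 h2].
by rewrite ger0_norm.
Qed.

Lemma rvbms_osimplex t : rvbms (osimplex t).
Proof.
split; last by apply: bounded_sub (@osimplex_sub t) (rvbms_csimplex t).2.
apply: rvsetI; last exact: (rvset_le rvfun_coordsum (rvfun_cst _)).
by apply: rvset_all => i; exact: (rvset_lt (rvfun_cst _) (rvfun_coord _)).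
Qed.

Lemma osimplex_scale (s t : R) : 0 < s -> [set x | osimplex t (s *: x)] = osimplex (s^-1 * t).
Proof.
move=> s0; apply/seteqP; split=> x /= [H1 H2]; split=> [i|].
- by have := H1 i; rewrite mxE pmulr_rgt0.
- rewrite ler_pdivlMl // mulr_sumr.
  by apply: le_trans H2; apply: ler_sum => i _; rewrite mxE.
- by rewrite mxE pmulr_rgt0.
- apply: le_trans (_ : s * \sum_i x 0 i <= _).
    by rewrite mulr_sumr; apply: ler_sum => i _; rewrite mxE.
  by rewrite -ler_pdivlMl.
Qed.

Lemma csimplex_scale (s t : R) : 0 < s -> [set x | csimplex t (s *: x)] = csimplex (s^-1 * t).
Proof.
move=> s0; apply/seteqP; split=> x /= [H1 H2]; split=> [i|].
- by have := H1 i; rewrite mxE pmulr_rge0.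
- rewrite ler_pdivlMl // mulr_sumr.
  by apply: le_trans H2; apply: ler_sum => i _; rewrite mxE.
- by rewrite mxE pmulr_rge0.
- apply: le_trans (_ : s * \sum_i x 0 i <= _).
    by rewrite mulr_sumr; apply: ler_sum => i _; rewrite mxE.
  by rewrite -ler_pdivlMl.
Qed.

Lemma vol_osimplex t : 0 < t -> vol (osimplex t) = t ^+ n * vol (osimplex 1).
Proof.
move=> t0; have ti : 0 < t^-1 by rewrite invr_gt0.
by rewrite -[t in LHS]mulr1 -{1}(invrK t) -osimplex_scale // vol_scale ?invrK //;
  exact: rvbms_osimplex.
Qed.

Lemma vol_csimplex t : 0 < t -> vol (csimplex t) = t ^+ n * vol (csimplex 1).
Proof.
move=> t0; have ti : 0 < t^-1 by rewrite invr_gt0.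
by rewrite -[t in LHS]mulr1 -{1}(invrK t) -csimplex_scale // vol_scale ?invrK //;
  exact: rvbms_csimplex.
Qed.

Lemma vol_osimplex_gt0 t : 0 < t -> 0 < vol (osimplex t).
Proof.
move=> t0; have [e e0 en] : exists2 e : R, 0 < e & n%:R * e <= t.
  exists (t / n.+1%:R); first by rewrite divr_gt0.
  by rewrite mulrCA ger_pMr // ler_pdivrMr // mul1r ler_nat.
apply: (@vol_gt0 _ _ _ (fun=> e / 2) (fun=> e)).
- exact: rvbms_osimplex.
- by move=> i; lra.
move=> x Hx; split=> [i|].
  by have /andP[h _] := Hx i; apply: lt_le_trans h; lra.
apply: le_trans en; rewrite mulr_natl -[X in _ *+ X]card_ord -sumr_const.
by apply: ler_sum => i _; have /andP[] := Hx i.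
Qed.

(* A small shift followed by a dilation moves the closed simplex inside the open one. *)
Lemma vol_csimplex_le : (0 < n)%N -> vol (csimplex 1) <= expR 1 * vol (osimplex 1).
Proof.
move=> n0; have n0R : 0 < n%:R :> R by rewrite ltr0n.
pose e : R := (n%:R ^+ 2)^-1.
have e0 : 0 < e by rewrite invr_gt0 exprn_gt0.
have ne : 1 + n%:R * e = 1 + n%:R^-1.
  by rewrite /e expr2 invfM mulrA divff ?gt_eqF // mul1r.
apply: (@le_trans _ _ (vol [set u | osimplex (1 + n%:R * e) (const_mx e + u)])).
  apply: le_vol; [exact: rvbms_csimplex|by apply: rvbms_trans; exact: rvbms_osimplex|].
  move=> u [u0 u1]; split=> [i|].
    by rewrite !mxE ltr_wpDr.
  rewrite (eq_bigr (fun i => e + u 0 i)); last by move=> i _; rewrite !mxE.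
  by rewrite big_split /= sumr_const card_ord -[e *+ n]mulr_natl addrC lerD2r.
rewrite vol_trans; last exact: rvbms_osimplex.
rewrite vol_osimplex ?ne; last by rewrite addr_gt0 ?invr_gt0.
rewrite ler_wpM2r ?vol_ge0 //.
apply: (@le_trans _ _ (expR n%:R^-1 ^+ n)).
  by apply: lerXn2r; rewrite ?nnegrE ?expR_ge0 ?addr_ge0 ?invr_ge0 ?expR_ge1Dx.
by rewrite -expRM_natr mulVf ?gt_eqF.
Qed.

Lemma rvint_scale (s : R) (U : set 'rV[R]_n) g : 0 < s ->
  rvbms U -> rvfun g -> (forall x, U x -> 0 <= g x) ->
  rvint [set x | U (s *: x)] (fun x => g (s *: x)) = s^-1 ^+ n * rvint U g.
Proof.
move=> s0 bU mg g0; have uM : (s%:M : 'M[R]_n) \in unitmx.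
  by rewrite unitmxE det_scalar unitfE expf_neq0 // gt_eqF.
have := @rvint_lin R n s%:M (s^-1 ^+ n) U g uM _ _ bU mg g0.
rewrite (_ : (fun x => _) = (fun x => g (s *: x))); last first.
  by apply/funext => x; rewrite mul_mx_scalar.
rewrite (_ : [set x | _] = [set x | U (s *: x)]); last first.
  by apply/seteqP; split=> x /=; rewrite mul_mx_scalar.
apply; first by rewrite exprn_ge0 // invr_ge0 ltW.
move=> A bA; rewrite -vol_scale //; congr vol.
by apply/seteqP; split=> x /=; rewrite mul_mx_scalar.
Qed.

Definition moment t (i j : 'I_n) : R := rvint (osimplex t) (fun u => u 0 i * u 0 j).

Lemma rvbfun_mom t i j : rvbfun (osimplex t) (fun u => u 0 i * u 0 j).
Proof. by apply: rvbfunM; apply: rvbfun_coord; exact: (rvbms_osimplex t).2. Qed.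

Lemma moment_perm t (s : {perm 'I_n}) i j : moment t (s i) (s j) = moment t i j.
Proof.
have E (x : 'rV[R]_n) k : (x *m perm_mx s^-1) 0 k = x 0 (s k).
  by rewrite -col_permE mxE.
have uM : (perm_mx s^-1 : 'M[R]_n) \in unitmx by exact: unitmx_perm.
have [k k0 Hk] := vol_lin uM.
have k1 : k = 1.
  have := Hk _ (rvbms_box (fun=> 0) (fun=> 1)).
  rewrite vol_box // [X in k * X]big1 => [|l _]; last by rewrite subr0.
  rewrite mulr1 => <-.
  rewrite [X in vol X](_ : _ = box (fun=> 0) (fun=> 1)).
    by rewrite vol_box // big1 // => l _; rewrite subr0.
  apply/seteqP; split=> x /= H l; last by rewrite E.
  by have := H ((s^-1)%g l); rewrite E permKV.
have := @rvint_lin R n _ k (osimplex t) (fun u => u 0 i * u 0 j) uM k0 Hk (rvbms_osimplex t)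
  (rvbfun_mom t i j).1.
rewrite /moment k1 mul1r => <-; last by move=> x [x0 _]; rewrite mulr_ge0 // ltW.
rewrite (_ : [set x | _] = osimplex t).
  by congr rvint; apply/funext => x; rewrite !E.
apply/seteqP; split=> x /= [H1 H2]; split=> [l|].
- by have := H1 ((s^-1)%g l); rewrite E permKV.
- apply: le_trans H2; rewrite (reindex_perm s) /=.
  by apply: ler_sum => l _; rewrite E.
- by rewrite E.
- apply: le_trans H2; rewrite [leRHS](reindex_perm s) /=.
  by apply: ler_sum => l _; rewrite E.
Qed.

Lemma moment_diag t i j : moment t i i = moment t j j.
Proof. by rewrite -(moment_perm t (tperm i j) i i) tpermL. Qed.

Lemma moment_off t i j k l : i != j -> k != l -> moment t i j = moment t k l.
Proof.
move=> ij kl; pose s1 := tperm i k; pose s2 := tperm (s1 j) l.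
rewrite -(moment_perm t (s1 * s2)%g) !permM.
have -> : s2 (s1 j) = l by rewrite tpermL.
have -> : s1 i = k by rewrite tpermL.
rewrite tpermD // 1?eq_sym //; apply: contra ij => /eqP E.
by apply/eqP; apply: (@perm_inj _ s1); rewrite tpermL.
Qed.

Lemma moment_ge0 t i j : 0 <= moment t i j.
Proof. by apply: rvint_ge0 => u [u0 _]; rewrite mulr_ge0 // ltW. Qed.

(* The part of the simplex where [u i > t / n] is a translate of the simplex of
   size [(1 - 1/n) t], which bounds the second moment in terms of itself. *)
Lemma moment_diag_le t i : (1 < n)%N -> 0 < t ->
  moment t i i <= 10 * (t / n%:R) ^+ 2 * vol (osimplex t).
Proof.
move=> n1 t0; have n0R : 0 < n%:R :> R by rewrite ltr0n; exact: ltnW.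
pose tau := t / n%:R; have tau0 : 0 < tau by rewrite divr_gt0.
pose r := 1 - n%:R^-1 : R.
have n1R : n%:R^-1 < 1 :> R by rewrite invf_lt1 // ltr1n.
have ni0 : 0 < n%:R^-1 :> R by rewrite invr_gt0.
have r0 : 0 < r by rewrite subr_gt0.
have r1 : r <= 1 by rewrite /r; lra.
have rt : t - tau = r * t by rewrite /r /tau; ring.
have rn : r ^+ n <= 1/2 by apply: expr_1BV_le_half; exact: ltnW.
pose A := osimplex t `&` [set u | u 0 i <= tau].
pose B := osimplex t `&` [set u | tau < u 0 i].
have bA : rvbms A.
  apply: rvbmsI; [exact: rvbms_osimplex|exact: (rvset_le (rvfun_coord _) (rvfun_cst _))].
have bB : rvbms B.
  apply: rvbmsI; [exact: rvbms_osimplex|exact: (rvset_lt (rvfun_cst _) (rvfun_coord _))].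
have EAB : osimplex t = A `|` B.
  apply/seteqP; split=> u /=; last by case=> -[].
  by move=> su; have [h|h] := leP (u 0 i) tau; [left|right].
pose D := - (tau *: 'e_i) : 'rV[R]_n.
have D0 u j : (D + u) 0 j = u 0 j - tau * (i == j)%:R.
  by rewrite !mxE eqxx /= eq_sym addrC.
have EB : B = [set u | osimplex (t - tau) (D + u)].
  have ES u : \sum_j (D + u) 0 j = \sum_j u 0 j - tau.
    rewrite (eq_bigr (fun j => u 0 j - tau * (i == j)%:R)) //.
    rewrite sumrB; congr (_ - _); rewrite (bigD1 i) //= eqxx mulr1 big1 ?addr0 //.
    by move=> j; rewrite eq_sym => /negbTE->; rewrite mulr0.
  apply/seteqP; split=> u /=.
    move=> [[u0 ut] ui]; split; last by rewrite ES lerD2r.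
    move=> j; rewrite D0; have [<-|ij] := eqVneq i j; first by rewrite mulr1 subr_gt0.
    by rewrite mulr0 subr0.
  move=> [u0]; rewrite ES lerD2r => ut; split; last by have := u0 i; rewrite D0 eqxx mulr1 subr_gt0.
  split=> // j; have := u0 j; rewrite D0; have [<-|ij] := eqVneq i j.
    by rewrite mulr1 subr_gt0 => /(lt_trans tau0).
  by rewrite mulr0 subr0.
have bm := rvbfun_mom t i i.
have b1 : rvbms (osimplex (t - tau)) by exact: rvbms_osimplex.
have IA : rvint A (fun u => u 0 i * u 0 i) <= tau ^+ 2 * vol (osimplex t).
  apply: (@le_trans _ _ (rvint A (fun=> tau ^+ 2))).
    apply: le_rvint => //; [by apply: rvbfun_sub bm => u []|exact: rvbfun_cst|].
    by move=> u [[u0 _] ui]; rewrite expr2 ler_pM // ltW.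
  rewrite rvint_cst // ler_wpM2l ?sqr_ge0 //; apply: le_vol => //; first exact: rvbms_osimplex.
  by move=> u [].
have vB : vol (osimplex (t - tau)) <= 1/2 * vol (osimplex t).
  rewrite rt vol_osimplex ?mulr_gt0 // [X in _ <= _ * X]vol_osimplex // exprMn -mulrA.
  by rewrite ler_wpM2r // mulr_ge0 ?vol_ge0 // exprn_ge0 // ltW.
have IB2 : rvint (osimplex (t - tau)) (fun u => u 0 i * u 0 i) <= 1/2 * moment t i i.
  have := @rvint_scale r^-1 (osimplex t) (fun u => u 0 i * u 0 i) _ (rvbms_osimplex t) bm.1.
  rewrite osimplex_scale ?invr_gt0 // invrK -rt => /(_ r0).
  have -> : (fun x : 'rV[R]_n => (r^-1 *: x) 0 i * (r^-1 *: x) 0 i) =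
     (fun x => r^-1 ^+ 2 * (x 0 i * x 0 i)).
    by apply/funext => x; rewrite !mxE; ring.
  rewrite rvintZ //; last exact: rvbfun_mom.
  move=> H; have {}H : r^-1 ^+ 2 * rvint (osimplex (t - tau)) (fun x => x 0 i * x 0 i) =
     r ^+ n * moment t i i by apply: H => x [x0 _]; rewrite mulr_ge0 // ltW.
  have -> : rvint (osimplex (t - tau)) (fun u => u 0 i * u 0 i) = r ^+ 2 * (r ^+ n * moment t i i).
    by rewrite -H mulrA -exprMn divff ?gt_eqF // expr1n mul1r.
  rewrite mulrA ler_wpM2r ?moment_ge0 //; apply: le_trans rn.
  by rewrite ger_pMl ?exprn_gt0 // exprn_ile1 // ltW.
(* Here (tau + v)^2 <= 3 tau^2 + (3/2) v^2: the coefficient of v^2 must stay below 2, since the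
   smaller simplex returns half of the moment. Adding the part over [A] gives m <= (5/2) tau^2 V +
   (3/4) m, hence the constant 10. *)
have IB : rvint B (fun u => u 0 i * u 0 i) <=
    3 * tau ^+ 2 * (1/2 * vol (osimplex t)) + 3/2 * (1/2 * moment t i i).
  have -> : (fun u : 'rV[R]_n => u 0 i * u 0 i) =
     (fun u => (fun v : 'rV[R]_n => (tau + v 0 i) * (tau + v 0 i)) (D + u)).
    by apply/funext => u; rewrite /= D0 eqxx mulr1; ring.
  have bc : rvbfun (osimplex (t - tau)) (fun v => tau + v 0 i).
    by apply: rvbfunD; [exact: rvbfun_cst|apply: rvbfun_coord; exact: b1.2].
  have bsq : rvbfun (osimplex (t - tau)) (fun v => v 0 i * v 0 i) by exact: rvbfun_mom.
  have bsz : rvbfun (osimplex (t - tau)) (fun v => 3/2 * (v 0 i * v 0 i)).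
    by apply: rvbfunM => //; exact: rvbfun_cst.
  rewrite EB (rvint_trans D b1 (rvbfunM bc bc).1); last first.
    by move=> v _; rewrite -expr2 sqr_ge0.
  apply: (@le_trans _ _ (rvint (osimplex (t - tau)) (fun v => 3 * tau ^+ 2 + 3/2 * (v 0 i * v 0 i)))).
    apply: le_rvint => //; first exact: rvbfunM.
      by apply: rvbfunD => //; exact: rvbfun_cst.
    move=> v _; rewrite -subr_ge0.
    have -> : 3 * tau ^+ 2 + 3/2 * (v 0 i * v 0 i) - (tau + v 0 i) * (tau + v 0 i) =
      1/2 * (2 * tau - v 0 i) ^+ 2 by field.
    by rewrite mulr_ge0 ?sqr_ge0.
  rewrite rvintD // ?rvint_cst ?rvintZ //; last exact: rvbfun_cst.
  by apply: lerD; apply: ler_wpM2l => //; rewrite mulr_ge0 ?sqr_ge0.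
have Em : moment t i i = rvint A (fun u => u 0 i * u 0 i) + rvint B (fun u => u 0 i * u 0 i).
  rewrite /moment {1}EAB rvint_setU //; last by rewrite -EAB.
  apply/seteqP; split=> u // [[_ /=]] h [_ /=]; by rewrite ltNge h.
rewrite -/tau; move: IA IB Em (sqr_ge0 tau) (vol_ge0 (osimplex t)).
move: (moment t i i) (rvint A _) (rvint B _) => m a b.
rewrite -[10 * _ * _]mulrA; set T := tau ^+ 2; set V := vol _.
rewrite -[3 * T * _]mulrA [T * (_ * V)]mulrCA; move: (T * V) => W *; lra.
Qed.

(** By symmetry there are only two moments, m1 off and m2 on the diagonal, and m1 <= m2. So the
    integral is m1 times the total of [Q] plus m2 - m1 times its trace, and n^2 m1 is at most the
    integral of (sum of the u_i)^2 <= t^2. The total thus receives the sharp constant 1 and only the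
    trace the crude 10; for the form used below the trace is smaller than the total by a factor of
    order d. *)
Lemma quadratic_moment_le t (Q : 'I_n -> 'I_n -> R) : (1 < n)%N -> 0 < t ->
  0 <= \sum_i \sum_j Q i j -> 0 <= \sum_i Q i i ->
  rvint (osimplex t) (fun u => \sum_i \sum_j Q i j * (u 0 i * u 0 j)) <=
  (t / n%:R) ^+ 2 * (\sum_i \sum_j Q i j + 10 * \sum_i Q i i) * vol (osimplex t).
Proof.
move=> n1 t0 Q1 Q2.
have n0R : 0 < n%:R :> R by rewrite ltr0n; exact: ltnW.
pose i0 : 'I_n := Ordinal (ltnW n1); pose i1 : 'I_n := Ordinal n1.
have b1 := rvbms_osimplex t.
pose m2 := moment t i0 i0; pose m1 := moment t i0 i1.
have Emom i j : moment t i j = m1 + (i == j)%:R * (m2 - m1).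
  have [<-|ij] := eqVneq i j; first by rewrite mul1r addrC subrK; exact: moment_diag.
  by rewrite mul0r addr0; exact: moment_off.
have bQ i j : rvbfun (osimplex t) (fun u => Q i j * (u 0 i * u 0 j)).
  by apply: rvbfunM; [exact: rvbfun_cst|exact: rvbfun_mom].
rewrite rvint_sum //; last by move=> i; exact: rvbfun_sum.
rewrite (eq_bigr (fun i => \sum_j Q i j * moment t i j)); last first.
  move=> i _; rewrite rvint_sum //; apply: eq_bigr => j _.
  by rewrite rvintZ //; exact: rvbfun_mom.
have -> : \sum_i \sum_j Q i j * moment t i j =
    m1 * (\sum_i \sum_j Q i j) + (m2 - m1) * \sum_i Q i i.
  rewrite !mulr_sumr -big_split /=; apply: eq_bigr => i _.
  rewrite (eq_bigr (fun j => m1 * Q i j + (m2 - m1) * (Q i j * (i == j)%:R))); last first.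
    by move=> j _; rewrite Emom; ring.
  rewrite big_split /= -!mulr_sumr; congr (_ + _ * _).
  rewrite (bigD1 i) //= eqxx mulr1 big1 ?addr0 // => j.
  by rewrite eq_sym => /negbTE->; rewrite mulr0.
have m12 : m1 <= m2.
  have : 0 <= rvint (osimplex t) (fun u => \sum_(k <- [:: (i0, i0, 1); (i1, i1, 1); (i0, i1, -2)])
     k.2 * (u 0 k.1.1 * u 0 k.1.2)).
    apply: rvint_ge0 => u _; rewrite !big_cons big_nil /=.
    have -> : 1 * (u 0 i0 * u 0 i0) + (1 * (u 0 i1 * u 0 i1) + (-2 * (u 0 i0 * u 0 i1) + 0)) =
      (u 0 i0 - u 0 i1) ^+ 2 by ring.
    exact: sqr_ge0.
  rewrite rvint_sum //; last first.
    by move=> k; apply: rvbfunM; [exact: rvbfun_cst|exact: rvbfun_mom].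
  rewrite !big_cons big_nil /= !rvintZ //; try exact: rvbfun_mom.
  rewrite -![rvint _ _]/(moment _ _ _) (moment_diag t i1 i0) -/m1 -/m2; lra.
have s1 : n%:R ^+ 2 * m1 <= t ^+ 2 * vol (osimplex t).
  apply: (@le_trans _ _ (rvint (osimplex t) (fun u => \sum_i \sum_j (u 0 i * u 0 j)))).
    rewrite rvint_sum //; last by move=> i; apply: rvbfun_sum => j; exact: rvbfun_mom.
    rewrite (eq_bigr (fun i => \sum_j moment t i j)); last first.
      by move=> i _; rewrite rvint_sum // => j; exact: rvbfun_mom.
    apply: (@le_trans _ _ (\sum_(i < n) \sum_(j < n) m1)).
      by rewrite !sumr_const !card_ord -mulrnA -[m1 *+ _]mulr_natl natrM expr2.
    apply: ler_sum => i _; apply: ler_sum => j _; rewrite Emom lerDl.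
    by rewrite mulr_ge0 // subr_ge0.
  rewrite -rvint_cst //; apply: le_rvint => //; last 1 first.
  - move=> u [u0 ut]; rewrite (eq_bigr (fun i => u 0 i * \sum_j u 0 j)); last first.
      by move=> i _; rewrite mulr_sumr.
    rewrite -mulr_suml -expr2; apply: lerXn2r; rewrite ?nnegrE //; last exact: ltW.
    by apply: sumr_ge0 => i _; exact: ltW.
  - by apply: rvbfun_sum => i; apply: rvbfun_sum => j; exact: rvbfun_mom.
  - exact: rvbfun_cst.
have s2 := moment_diag_le i0 n1 t0; rewrite -/m2 in s2.
have m10 : 0 <= m1 by exact: moment_ge0.
have {}s1 : m1 <= (t / n%:R) ^+ 2 * vol (osimplex t).
  by rewrite exprMn exprVn mulrAC ler_pdivlMr ?exprn_gt0 // mulrC.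
set T := (t / n%:R) ^+ 2 in s1 s2 *.
have -> : T * (\sum_i \sum_j Q i j + 10 * \sum_i Q i i) * vol (osimplex t) =
  (T * vol (osimplex t)) * (\sum_i \sum_j Q i j) + (10 * T * vol (osimplex t)) * (\sum_i Q i i) by ring.
apply: lerD; apply: ler_wpM2r => //; lra.
Qed.

End simplex.


(** * Sectors of one simplex *)

Section inner_theory.
Context (R : realType) (n : nat).
Implicit Types x y z : 'rV[R]_n.

Lemma innerC x y : inner x y = inner y x.
Proof. by apply: eq_bigr => i _; rewrite mulrC. Qed.

Lemma innerDl x y z : inner (x + y) z = inner x z + inner y z.
Proof. by rewrite -big_split; apply: eq_bigr => i _; rewrite mxE mulrDl. Qed.

Lemma innerDr x y z : inner x (y + z) = inner x y + inner x z.
Proof. by rewrite innerC innerDl !(innerC x). Qed.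

Lemma innerZl a x y : inner (a *: x) y = a * inner x y.
Proof. by rewrite mulr_sumr; apply: eq_bigr => i _; rewrite mxE mulrA. Qed.

Lemma innerZr a x y : inner x (a *: y) = a * inner x y.
Proof. by rewrite innerC innerZl innerC. Qed.

Lemma innerNl x y : inner (- x) y = - inner x y.
Proof. by rewrite -scaleN1r innerZl mulN1r. Qed.

Lemma innerNr x y : inner x (- y) = - inner x y.
Proof. by rewrite innerC innerNl innerC. Qed.

Lemma inner0l x : inner 0 x = 0.
Proof. by rewrite -(scale0r 0) innerZl mul0r. Qed.

Lemma inner0r x : inner x 0 = 0.
Proof. by rewrite innerC inner0l. Qed.

Lemma inner_suml (I : Type) (r : seq I) P (F : I -> 'rV[R]_n) y :
  inner (\sum_(i <- r | P i) F i) y = \sum_(i <- r | P i) inner (F i) y.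
Proof.
apply: (big_morph (fun x => inner x y)); last exact: inner0l.
by move=> a b; exact: innerDl.
Qed.

Lemma inner_sumr (I : Type) (r : seq I) P (F : I -> 'rV[R]_n) y :
  inner y (\sum_(i <- r | P i) F i) = \sum_(i <- r | P i) inner y (F i).
Proof. by rewrite innerC inner_suml; apply: eq_bigr => i _; rewrite innerC. Qed.

Lemma inner_ge0 x : 0 <= inner x x.
Proof. by apply: sumr_ge0 => i _; rewrite -expr2 sqr_ge0. Qed.

Lemma inner_eq0 x : (inner x x == 0) = (x == 0).
Proof.
apply/idP/eqP => [|->]; last by rewrite inner0l.
rewrite psumr_eq0 => [/allP H|i _]; last by rewrite -expr2 sqr_ge0.
apply/rowP => i; have := H i (mem_index_enum _).
by rewrite -expr2 sqrf_eq0 mxE => /eqP.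
Qed.

Lemma inner_gt0 x : (0 < inner x x) = (x != 0).
Proof. by rewrite lt_neqAle inner_ge0 andbT eq_sym inner_eq0. Qed.

Lemma cauchy_schwarz x y : inner x y ^+ 2 <= inner x x * inner y y.
Proof.
have [->|x0] := eqVneq x 0; first by rewrite !inner0l expr0n mul0r.
have := inner_ge0 (inner x x *: y - inner x y *: x).
rewrite innerDl !innerDr !innerNl !innerNr !innerZl !innerZr (innerC y x).
move=> H; have : 0 <= inner x x * (inner x x * inner y y - inner x y ^+ 2).
  by move: H; congr (0 <= _); ring.
by rewrite pmulr_rge0 ?inner_gt0 // subr_ge0.
Qed.

Lemma coord_le_norm x i : `|x 0 i| <= Num.sqrt (inner x x).
Proof.
rewrite -sqrtr_sqr ler_sqrt ?inner_ge0 // /inner (bigD1 i) //= -expr2 lerDl.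
by apply: sumr_ge0 => j _; rewrite -expr2 sqr_ge0.
Qed.

Definition ball1 : set 'rV[R]_n := [set z | inner z z <= 1].

(** For unit [x] and [0 <= gam <= 1], the cone over the cap around [x] whose angle has cosine [gam],
    written without division so that it contains 0. *)
Definition capcone (gam : R) x : set 'rV[R]_n :=
  [set z | inner z z <= 1 /\ gam * Num.sqrt (inner z z) <= inner x z].

Lemma rvbms_ball1 : rvbms ball1.
Proof.
split; first exact: (rvset_le (rvfun_inner (@rvmap_id _ _) (@rvmap_id _ _)) (rvfun_cst _)).
exists 1 => x i /= x1; apply: le_trans (coord_le_norm x i) _.
by rewrite -sqrtr1 ler_sqrt.
Qed.

Lemma rvbms_capcone gam x : rvbms (capcone gam x).
Proof.
have m1 := rvfun_inner (@rvmap_id R n) (@rvmap_id R n).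
apply: (rvbmsI rvbms_ball1); apply: rvset_le.
  by apply: rvfunM; [exact: rvfun_cst|exact: rvfun_sqrt].
by apply: rvfun_inner; [exact: rvmap_cst|exact: rvmap_id].
Qed.

End inner_theory.

Arguments ball1 : clear implicits.

(** * The simplex in coordinates adapted to one of its vertices *)

Section pyramid.
Context (R : realType) (d : nat).

Definition pyramid (H : R) : set 'rV[R]_d.+1 :=
  [set x | (forall j, 0 <= rvtail x 0 j) /\ \sum_j rvtail x 0 j <= rvhead x <= H].

Lemma pyramid_slab H : pyramid H `<=` [set x | 0 <= rvhead x <= H /\ csimplex H (rvtail x)].
Proof.
move=> x [x0 /andP[x1 x2]]; split; last by split=> //; exact: le_trans x2.
by rewrite x2 andbT; apply: le_trans x1; apply: sumr_ge0.
Qed.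

Lemma rvbms_pyramid H : rvbms (pyramid H).
Proof.
split; last by apply: bounded_sub (@pyramid_slab H) (rvbms_slab _ _ (rvbms_csimplex _ _)).2.
have mt : rvfun (fun x : 'rV[R]_d.+1 => \sum_j rvtail x 0 j).
  by apply: rvfun_sum => j; exact: rvmap_tail.
rewrite (_ : pyramid H = [set x | forall j, 0 <= rvtail x 0 j] `&`
   ([set x | \sum_j rvtail x 0 j <= rvhead x] `&` [set x | rvhead x <= H])).
  apply: rvsetI.
    by apply: rvset_all => j; apply: rvset_le; [exact: rvfun_cst|exact: rvmap_tail].
  apply: rvsetI; apply: rvset_le => //; try exact: rvfun_head.
  exact: rvfun_cst.
by apply/seteqP; split=> x [x0]; [move=> /andP[]|move=> [? ?]; split=> //; apply/andP].
Qed.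

Lemma vol_pyramid_gt0 H : 0 < H -> 0 < vol (pyramid H).
Proof.
move=> H0; have H20 : 0 < H / 2 by rewrite divr_gt0.
have bs := rvbms_slab (H / 2) H (rvbms_osimplex d (H / 2)).
apply: (@lt_le_trans _ _ (vol [set x | H / 2 <= rvhead x <= H /\ osimplex (H / 2) (rvtail x)])).
  rewrite vol_slab; [|exact: rvbms_osimplex|lra].
  by rewrite mulr_gt0 ?vol_osimplex_gt0 // subr_gt0; lra.
apply: le_vol => //; first exact: rvbms_pyramid.
move=> x [/andP[x1 x2] [t0 t1]]; split=> [j|]; first exact: ltW.
by rewrite x2 andbT; apply: le_trans x1.
Qed.

(* Cutting off the top slice of height [H / d.+1] leaves a pyramid of at most half the volume. *)
Lemma vol_pyramid_le H : 0 < H -> vol (pyramid H)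
  <= 2 * H ^+ d.+1 / d.+1%:R * vol (@csimplex R d 1).
Proof.
move=> H0; pose q := 1 - d.+1%:R^-1 : R.
have [d0|d0] := posnP d.
  have E : q = 0 by rewrite /q d0 invr1 subrr.
  apply: (@le_trans _ _ (vol [set x | 0 <= rvhead x <= H /\ csimplex H (rvtail x)])).
    by apply: le_vol; [exact: rvbms_pyramid|exact/rvbms_slab/rvbms_csimplex|exact: pyramid_slab].
  rewrite vol_slab; [|exact: rvbms_csimplex|exact: ltW].
  rewrite vol_csimplex // subr0 mulrA -exprS ler_wpM2r ?vol_ge0 //.
  have -> : d.+1%:R = 1 :> R by rewrite d0.
  by rewrite divr1 ler_peMl ?exprn_ge0 ?ltW // ltr1n.
have D0 : 0 < d.+1%:R^-1 :> R by rewrite invr_gt0.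
have q0 : 0 < q by rewrite subr_gt0 invf_lt1 // ltr1n.
have qi : 0 < q^-1 by rewrite invr_gt0.
have bp := rvbms_pyramid H.
have bq := rvbms_scale qi bp.
have bs := rvbms_slab (q * H) H (rvbms_csimplex d H).
have : vol (pyramid H) <= 1/2 * vol (pyramid H) + (H - q * H) * vol (@csimplex R d H).
  apply: (@le_trans _ _ (vol ([set x | pyramid H (q^-1 *: x)] `|`
      [set x | q * H <= rvhead x <= H /\ csimplex H (rvtail x)]))).
    apply: le_vol => //; first exact: rvbmsU.
    move=> x xH; have [x0 /andP[x1 x2]] := xH; have [_ x3] := pyramid_slab xH.
    have [h|h] := leP (q * H) (rvhead x); [by right; rewrite /= h x2|left].
    split=> [j|]; first by rewrite !mxE; have := x0 j; rewrite !mxE pmulr_rge0.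
    rewrite (eq_bigr (fun j => q^-1 * rvtail x 0 j)); last by move=> j _; rewrite !mxE.
    rewrite -mulr_sumr /rvhead mxE ler_wpM2l ?(ltW qi) //=.
    by rewrite ler_pdivrMl // mulrC ltW // mulrC.
  apply: le_trans (vol_setU_le _ _) _ => //.
  rewrite vol_slab; [|exact: rvbms_csimplex|by rewrite ger_pMl // lerBlDr lerDl ltW].
  rewrite lerD2r vol_scale // invrK ler_wpM2r ?vol_ge0 //.
  exact: expr_1BV_le_half.
have -> : H - q * H = H / d.+1%:R by rewrite /q; ring.
rewrite (vol_csimplex d H0) => h.
rewrite (_ : _ * vol (csimplex 1) = 2 * (H / d.+1%:R * (H ^+ d * vol (@csimplex R d 1))));
  last first.
  by rewrite exprS; ring.
by move: h; move: (H / _ * _) (vol (pyramid H)) => W P h; lra.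
Qed.

End pyramid.

Section sector.
Context (R : realType) (d : nat).
Implicit Types (V : 'M[R]_d.+1) (j : 'I_d.+1).

Definition kcone V : set 'rV[R]_d.+1 := [set z | forall k, 0 <= (z *m invmx V) 0 k].

(** The coordinate at [j] is free: this is the tangent cone of [kcone V] along the ray of its j-th
    row. The inequalities are strict so that sectors at one point are disjoint as sets, whereas
    [kcone] is closed so that the cones cover; [vol_csimplex_le] pays for the difference without any
    statement on null sets. *)
Definition sector V j : set 'rV[R]_d.+1 :=
  [set z | forall k, k != j -> 0 < (z *m invmx V) 0 k].

(** For invertible [V], a full-dimensional simplex: its vertices are 0 and the rows of [V] scaled by
    [H]. *)
Definition facet V (H : R) : set 'rV[R]_d.+1 :=
  [set z | (forall k, 0 <= (z *m invmx V) 0 k) /\ \sum_k (z *m invmx V) 0 k <= H].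

(* Maps [(s, u)] to the vector with [u] at the coordinates other than [j] and total sum [s]. *)
Definition pivot j : 'M[R]_d.+1 :=
  \matrix_(i, l) (if unlift 0 i is Some k then (l == lift j k)%:R - (l == j)%:R
                  else (l == j)%:R).

Lemma pivotE j x l : (x *m pivot j) 0 l =
  rvhead x * (l == j)%:R + \sum_k rvtail x 0 k * ((l == lift j k)%:R - (l == j)%:R).
Proof.
rewrite mxE big_ord_recl; congr (_ + _); first by rewrite mxE unlift_none.
by apply: eq_bigr => k _; rewrite !mxE liftK.
Qed.

Lemma pivot_lift j x k : (x *m pivot j) 0 (lift j k) = rvtail x 0 k.
Proof.
rewrite pivotE eq_sym (negbTE (neq_lift _ _)) mulr0 add0r (bigD1 k) //= eqxx subr0 mulr1.
rewrite big1 ?addr0 // => l lk; rewrite subr0 (inj_eq lift_inj) eq_sym (negbTE lk).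
by rewrite mulr0.
Qed.

Lemma pivot_j j x : (x *m pivot j) 0 j = rvhead x - \sum_k rvtail x 0 k.
Proof.
rewrite pivotE eqxx mulr1 -sumrN; congr (_ + _); apply: eq_bigr => k _.
by rewrite (negbTE (neq_lift _ _)) sub0r mulrN1.
Qed.

Lemma big_lift j (F : 'I_d.+1 -> R) : \sum_l F l = F j + \sum_k F (lift j k).
Proof. by rewrite (bigD1_ord j). Qed.

Lemma pivot_sum j x : \sum_l (x *m pivot j) 0 l = rvhead x.
Proof.
rewrite (big_lift j) pivot_j.
under [X in _ + X]eq_bigr do rewrite pivot_lift.
by rewrite subrK.
Qed.

Lemma row_inj_unitmx n (M : 'M[R]_n) : (forall x : 'rV_n, x *m M = 0 -> x = 0) -> M \in unitmx.
Proof.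
move=> H; rewrite -row_free_unit -kermx_eq0; apply/eqP/row_matrixP => i.
by rewrite row0; apply: H; rewrite -row_mul mulmx_ker row0.
Qed.

Lemma pivot_unit j : pivot j \in unitmx.
Proof.
apply: row_inj_unitmx => x x0.
have H0 : rvhead x = 0 by rewrite -(pivot_sum j) x0 big1 // => l _; rewrite mxE.
rewrite -(rvcons_eta x) H0; apply/rowP => i; case: (unliftP 0 i) => [k ->|->].
  by rewrite rvconsS -(pivot_lift j) x0 !mxE.
by rewrite rvcons0 mxE.
Qed.

(** The right side does not depend on [j], so the coordinate systems at all vertices have the same
    volume factor. *)
Lemma pivot_facet V H j : V \in unitmx -> [set x | facet V H (x *m (pivot j *m V))] = pyramid H.
Proof.
move=> uV; apply/seteqP; split=> x /=; rewrite /facet /pyramid /= mulmxA mulmxK // pivot_sum.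
  move=> [x0 xH]; split=> [k|]; first by rewrite -(pivot_lift j).
  by rewrite xH andbT -subr_ge0 -(pivot_j j).
move=> [x0 /andP[x1 x2]]; split=> // l; case: (unliftP j l) => [k ->|->].
  by rewrite pivot_lift.
by rewrite pivot_j subr_ge0.
Qed.

Lemma mul_pivot V j a u : rvcons a u *m (pivot j *m V) =
  a *: row j V + \sum_k u 0 k *: (row (lift j k) V - row j V).
Proof.
rewrite mulmxA mulmx_sum_row (bigD1_ord j) //= pivot_j rvhead_cons rvtail_cons.
rewrite (eq_bigr (fun k => u 0 k *: row (lift j k) V)); last first.
  by move=> k _; rewrite pivot_lift rvtail_cons.
under [in RHS]eq_bigr do rewrite scalerBr.
rewrite [in RHS]big_split /= scalerBl -!addrA; congr (_ + _).
by rewrite addrC sumrN scaler_suml.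
Qed.

Lemma rvbms_kcone_ball V : rvbms (kcone V `&` ball1 R d.+1).
Proof.
rewrite setIC; apply: rvbmsI; first exact: rvbms_ball1.
apply: rvset_all => k; apply: rvset_le; first exact: rvfun_cst.
by apply: rvmap_mul; exact: rvmap_id.
Qed.

Lemma rvbms_sector_capcone V j gam v : rvbms (sector V j `&` capcone gam v).
Proof.
rewrite setIC; apply: rvbmsI; first exact: rvbms_capcone.
apply: rvset_all => k; apply: rvset_impl.
apply: rvset_lt; first exact: rvfun_cst.
by apply: rvmap_mul; exact: rvmap_id.
Qed.

End sector.


(** * The density estimate in one simplex *)

Section simplex_density.
Context (R : realType) (d : nat) (V : 'M[R]_d.+1).
Hypothesis uV : V \in unitmx.
Hypothesis V1 : forall k, inner (row k V) (row k V) = 1.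
Implicit Types (j : 'I_d.+1) (u : 'rV[R]_d).

Definition edge j (k : 'I_d) : 'rV[R]_d.+1 := row (lift j k) V - row j V.
Definition edge_comb j u : 'rV[R]_d.+1 := \sum_k u 0 k *: edge j k.

Lemma inner_row_le1 k l : inner (row k V) (row l V) <= 1.
Proof.
have := inner_ge0 (row k V - row l V).
rewrite innerDl !innerDr !innerNl !innerNr !V1 (innerC (row l V)); lra.
Qed.

(** The point is z = a v + w with v the j-th row and w the edge combination. The distance from a v
    to the line through z is at most |w|, so |w| <= rho a bounds the sine of the angle between v and
    z by rho. As <v, w> <= 0, also |z|^2 <= a^2 (1 + rho^2), and [a <= 1 - rho ^+ 2] keeps z in the
    unit ball. *)
Lemma sector_sub (rho gam a : R) j u : 0 < rho -> rho < 1 -> 0 <= gam ->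
  gam ^+ 2 = 1 - rho ^+ 2 -> (forall k, 0 < u 0 k) -> 0 <= a -> a <= 1 - rho ^+ 2 ->
  inner (edge_comb j u) (edge_comb j u) <= (rho * a) ^+ 2 ->
  (sector V j `&` capcone gam (row j V)) (rvcons a u *m (pivot R j *m V)).
Proof.
move=> r0 r1 g0 gE u0 a0 a1 Hw.
split.
  move=> k kj; rewrite mulmxA mulmxK //; case: (unliftP j k) kj => [l ->|->]; last first.
    by rewrite eqxx.
  by rewrite pivot_lift rvtail_cons.
rewrite mul_pivot -/(edge_comb j u); set v := row j V; set w := edge_comb j u in Hw *.
have w0 := inner_ge0 w; have v1 : inner v v = 1 by exact: V1.
have vw0 : inner v w <= 0.
  rewrite inner_sumr; apply: sumr_le0 => k _; rewrite innerZr mulr_ge0_le0 ?(ltW (u0 k)) //.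
  by rewrite innerDr innerNr v1 subr_le0 inner_row_le1.
have CS : inner v w ^+ 2 <= inner w w by have := cauchy_schwarz v w; rewrite v1 mul1r.
have ra : 0 <= rho * a by rewrite mulr_ge0 // ltW.
have vwa : - (rho * a) <= inner v w.
  rewrite -[X in _ <= X]opprK lerN2 -(@ler_pXn2r _ 2) ?nnegrE ?oppr_ge0 //.
  by rewrite sqrrN; apply: le_trans CS Hw.
have Ez : inner (a *: v + w) (a *: v + w) = a ^+ 2 + 2 * a * inner v w + inner w w.
  by rewrite innerDl !innerDr !innerZl !innerZr v1 (innerC w v); ring.
have rr0 : 0 <= rho ^+ 2 by exact: sqr_ge0.
have rr1 : rho ^+ 2 <= 1 by rewrite expr_le1 // ltW.
have r1a : rho * a <= a by rewrite ler_piMl // ltW.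
split; rewrite /= Ez.
  have h1 : a * inner v w <= 0 by rewrite mulr_ge0_le0.
  have h2 : a ^+ 2 <= (1 - rho ^+ 2) ^+ 2.
    by apply: lerXn2r; rewrite ?nnegrE //; lra.
  apply: (@le_trans _ _ (a ^+ 2 * (1 + rho ^+ 2))).
    by move: Hw; rewrite exprMn; lra.
  apply: (@le_trans _ _ ((1 - rho ^+ 2) ^+ 2 * (1 + rho ^+ 2))).
    by apply: ler_wpM2r => //; lra.
  have -> : (1 - rho ^+ 2) ^+ 2 * (1 + rho ^+ 2) = 1 - rho ^+ 2 * (1 + rho ^+ 2 * (1 - rho ^+ 2)).
    by ring.
  rewrite lerBlDr lerDl mulr_ge0 // ?rr0 //.
  by rewrite addr_ge0 // mulr_ge0 // ?rr0 // subr_ge0 rr1.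
rewrite innerDr innerZr v1 mulr1.
have av : 0 <= a + inner v w by lra.
rewrite -(@ler_pXn2r _ 2) // ?nnegrE ?mulr_ge0 ?sqrtr_ge0 //.
rewrite exprMn gE sqr_sqrtr; last by rewrite -Ez inner_ge0.
rewrite -subr_ge0.
have -> : (a + inner v w) ^+ 2 - (1 - rho ^+ 2) * (a ^+ 2 + 2 * a * inner v w + inner w w) =
   (rho ^+ 2 * a + inner v w) ^+ 2 + (1 - rho ^+ 2) * ((rho * a) ^+ 2 - inner w w) by ring.
by rewrite addr_ge0 ?sqr_ge0 // mulr_ge0 ?subr_ge0 // rr1.
Qed.

Definition rowsum : 'rV[R]_d.+1 := \sum_k row k V.
(** The same [u] is used at all vertices, although its coordinates belong to different edges at
    different [j]; the squared lengths then add up to a single quadratic form in [u]. *)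
Definition gram (k l : 'I_d) : R := \sum_j inner (edge j k) (edge j l).
Local Notation D := (d.+1%:R : R).

Lemma edge_sum j : \sum_k edge j k = rowsum - D *: row j V.
Proof.
rewrite sumrB sumr_const card_ord /rowsum (bigD1_ord j) //= -scaler_nat.
by rewrite -(natr1 d) scalerDl scale1r opprD [row j V + _]addrC addrACA subrr addr0.
Qed.

(** The total is D/2 times the trace computed in [gram_trace], which is the sum of the squared
    distances over all ordered pairs of vertices. Hence the crude constant on the trace in
    [quadratic_moment_le] costs only a relative error of order 1/d. *)
Lemma gram_total : \sum_k \sum_l gram k l = D * (D ^+ 2 - inner rowsum rowsum).
Proof.
transitivity (\sum_j inner (\sum_k edge j k) (\sum_l edge j l)).
  under eq_bigr do rewrite exchange_big /=.
  rewrite exchange_big /=; apply: eq_bigr => j _.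
  rewrite inner_suml; apply: eq_bigr => k _; by rewrite inner_sumr.
transitivity (\sum_j (inner rowsum rowsum + D ^+ 2 - 2 * D * inner rowsum (row j V))).
  apply: eq_bigr => j _; rewrite edge_sum innerDl !innerDr !innerNl !innerNr.
  by rewrite !innerZl !innerZr V1 (innerC (row j V)); ring.
rewrite sumrB -mulr_sumr -inner_sumr -/rowsum sumr_const card_ord -mulr_natl; ring.
Qed.

Lemma gram_trace : \sum_k gram k k = 2 * (D ^+ 2 - inner rowsum rowsum).
Proof.
transitivity (\sum_j \sum_l (2 - 2 * inner (row l V) (row j V))).
  rewrite exchange_big /=; apply: eq_bigr => j _.
  rewrite (big_lift j (fun l => 2 - _)) V1 mulr1 subrr add0r; apply: eq_bigr => k _.
  by rewrite innerDl !innerDr !innerNl !innerNr !V1 (innerC (row j V)); ring.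
under eq_bigr do rewrite sumrB -mulr_sumr -inner_suml -/rowsum.
rewrite sumrB -mulr_sumr -inner_sumr -/rowsum !sumr_const !card_ord -mulrnA -[_ *+ (_ * _)]mulr_natr natrM.
ring.
Qed.

Lemma edge_comb_sum u : \sum_j inner (edge_comb j u) (edge_comb j u) =
  \sum_k \sum_l gram k l * (u 0 k * u 0 l).
Proof.
transitivity (\sum_j \sum_k \sum_l inner (edge j k) (edge j l) * (u 0 k * u 0 l)).
  apply: eq_bigr => j _; rewrite inner_suml; apply: eq_bigr => k _.
  rewrite inner_sumr; apply: eq_bigr => l _; rewrite innerZl innerZr; ring.
rewrite exchange_big /=; apply: eq_bigr => k _.
rewrite exchange_big /=; apply: eq_bigr => l _.
by rewrite mulr_suml.
Qed.


Lemma rvbfun_edge_comb j t : rvbfun (osimplex t) (fun u => inner (edge_comb j u) (edge_comb j u)).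
Proof.
rewrite (_ : (fun _ => _) = (fun u : 'rV[R]_d => \sum_k \sum_l
   inner (edge j k) (edge j l) * (u 0 k * u 0 l))).
  apply: rvbfun_sum => k; apply: rvbfun_sum => l; apply: rvbfunM; first exact: rvbfun_cst.
  exact: rvbfun_mom.
apply/funext => u; rewrite inner_suml; apply: eq_bigr => k _.
rewrite inner_sumr; apply: eq_bigr => l _; rewrite innerZl innerZr; ring.
Qed.

(* [r <= (r^2/t + t)/2] replaces the length of [edge_comb j u] by a quadratic form. *)
Lemma vol_sector_ge (rho gam t : R) j : 0 < rho -> rho < 1 -> 0 <= gam ->
  gam ^+ 2 = 1 - rho ^+ 2 -> 0 < t ->
  rvint (osimplex t) (fun u => (1 - rho ^+ 2 - t / 2) +
     - (2 * t * rho ^+ 2)^-1 * inner (edge_comb j u) (edge_comb j u)) <=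
  vol [set x | (sector V j `&` capcone gam (row j V)) (x *m (pivot R j *m V))].
Proof.
move=> r0 r1 g0 gE t0; have uP : pivot R j *m V \in unitmx by rewrite unitmx_mul pivot_unit.
have c0 : 0 < (2 * t * rho ^+ 2)^-1 by rewrite invr_gt0 !mulr_gt0 ?exprn_gt0.
apply: (@rvint_le_vol _ _ _ _ _ (1 - rho ^+ 2)).
- exact: rvbms_osimplex.
- by apply: rvbms_mul => //; exact: rvbms_sector_capcone.
- apply: rvbfunD; first exact: rvbfun_cst.
  by apply: rvbfunM; [exact: rvbfun_cst|exact: rvbfun_edge_comb].
move=> u a [u0 _] /andP[a1 a2]; apply: (@sector_sub rho) => //.
  set q := inner _ _ in a1; have q0 : 0 <= q by exact: inner_ge0.
  apply: le_trans a1; have : 0 <= (2 * t * rho ^+ 2)^-1 * q by rewrite mulr_ge0 // ltW.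
  lra.
set q := inner _ _ in a1 *; have q0 : 0 <= q by exact: inner_ge0.
have [p p0 qE] : exists2 p, 0 <= p & q = (rho * p) ^+ 2.
  exists (Num.sqrt q / rho); first by rewrite divr_ge0 ?sqrtr_ge0 // ltW.
  by rewrite mulrCA divff ?gt_eqF // mulr1 sqr_sqrtr.
rewrite qE; apply: lerXn2r; rewrite ?nnegrE ?mulr_ge0 ?(ltW r0) //.
  apply: le_trans a1; have : 0 <= (2 * t * rho ^+ 2)^-1 * q by rewrite mulr_ge0 // ltW.
  lra.
rewrite ler_wpM2l ?(ltW r0) //; apply: le_trans a1.
have E : (2 * t * rho ^+ 2)^-1 * q = p ^+ 2 / (2 * t).
  by rewrite qE; field; rewrite !gt_eqF.
have : 0 <= (p - t) ^+ 2 / (2 * t) by rewrite divr_ge0 ?sqr_ge0 // mulr_ge0 // ltW.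
have -> : (p - t) ^+ 2 / (2 * t) = p ^+ 2 / (2 * t) - p + t / 2.
  by field; rewrite gt_eqF.
by move: E; rewrite mulNr => ->; lra.
Qed.

(** Summed over [j], the quadratic parts of [vol_sector_ge] amount to at most D (t/2) (1 + 50/d)
    times the volume of the simplex. Together with the terms t/2 this leaves D (1 - rho^2 - t (1 +
    25/d)), and the last hypothesis keeps the bracket at least 1/(4 d); hence the constant 1/4. *)
Lemma sum_vol_sector_ge (rho gam t H : R) y : (1 < d)%N ->
  0 < rho -> rho < 1 -> 0 <= gam -> gam ^+ 2 = 1 - rho ^+ 2 -> 0 < t -> 0 < H ->
  (forall k, 1 <= inner y (row k V)) -> inner y y <= H ^+ 2 ->
  1 - H ^- 2 <= rho ^+ 2 * (1 + d%:R^-1) ->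
  t * (1 + 25 / d%:R) + (4 * d%:R)^-1 <= 1 - rho ^+ 2 ->
  vol (@osimplex R d t) / 4 <=
  \sum_j vol [set x | (sector V j `&` capcone gam (row j V)) (x *m (pivot R j *m V))].
Proof.
move=> d1 r0 r1 g0 gE t0 H0 y1 yH Hr Ht.
have dR : 2 <= d%:R :> R by rewrite (ler_nat _ 2).
have b1 := rvbms_osimplex d t.
apply: (@le_trans _ _ (\sum_j ((1 - rho ^+ 2 - t / 2) * vol (@osimplex R d t) +
    - (2 * t * rho ^+ 2)^-1 * rvint (osimplex t) (fun u => inner (edge_comb j u) (edge_comb j u)))));
  last first.
  apply: ler_sum => j _; apply: le_trans (@vol_sector_ge rho gam t j r0 r1 g0 gE t0).
  rewrite rvintD //; first last.
  - by apply: rvbfunM; [exact: rvbfun_cst|exact: rvbfun_edge_comb].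
  - exact: rvbfun_cst.
  by rewrite rvint_cst // rvintZ //; exact: rvbfun_edge_comb.
rewrite big_split /= -[X in _ <= _ + X]mulr_sumr.
have /= <- := rvint_sum (index_enum 'I_d.+1) b1 (fun j => rvbfun_edge_comb j t).
rewrite sumr_const card_ord.
under eq_fun do rewrite edge_comb_sum.
pose R2 := D ^+ 2 - inner rowsum rowsum.
have R20 : 0 <= R2.
  have : 0 <= \sum_k gram k k.
    by apply: sumr_ge0 => k _; apply: sumr_ge0 => j _; exact: inner_ge0.
  by rewrite gram_trace pmulr_rge0.
(* [R2 / D ^+ 2] is the mean squared distance of the vertices from their centroid, that is, 1 minus
   the squared norm of the centroid. The centroid lies in the half-space <y, .> >= 1, so its norm is
   at least 1/H. *)
have R2H : R2 <= D ^+ 2 * (rho ^+ 2 * (1 + d%:R^-1)).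
  apply: le_trans (_ : D ^+ 2 * (1 - H ^- 2) <= _); last by rewrite ler_wpM2l ?sqr_ge0.
  rewrite mulrBr mulr1 lerB // ler_pdivrMr ?exprn_gt0 //.
  have DyB : D <= inner y rowsum.
    rewrite inner_sumr -[X in X%:R]card_ord -sumr_const; exact: ler_sum.
  apply: (@le_trans _ _ (inner y rowsum ^+ 2)).
    by apply: lerXn2r; rewrite ?nnegrE // (le_trans _ DyB).
  apply: le_trans (cauchy_schwarz _ _) _.
  by rewrite mulrC ler_wpM2l // inner_ge0.
have Q := @quadratic_moment_le R d t gram d1 t0.
rewrite gram_total gram_trace -/R2 in Q.
have {}Q := Q (mulr_ge0 (ler0n _ _) R20) (mulr_ge0 (ler0n _ 2) R20).
have v0 := vol_ge0 (@osimplex R d t).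
set I := rvint _ _ in Q *.
have di0 : 0 < d%:R^-1 :> R by rewrite invr_gt0; lra.
have di1 : d%:R^-1 <= 1/2 :> R by rewrite div1r lef_pV2 ?posrE //; lra.
have dd : d%:R * d%:R^-1 = 1 :> R by rewrite divff //; lra.
set e := d%:R^-1 in di0 di1 dd Q R2H Ht *.
have c0 : 0 < (2 * t * rho ^+ 2)^-1 by rewrite invr_gt0 !mulr_gt0 ?exprn_gt0.
have I1 : (2 * t * rho ^+ 2)^-1 * I <=
    D * (t / 2) * (1 + 50 * e) * vol (@osimplex R d t).
  apply: (@le_trans _ _ ((2 * t * rho ^+ 2)^-1 *
     ((t * e) ^+ 2 * (D + 20) * (D ^+ 2 * (rho ^+ 2 * (1 + e))) * vol (@osimplex R d t)))).
    rewrite ler_wpM2l ?(ltW c0) //; apply: le_trans Q _.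
    rewrite ler_wpM2r //.
    have -> : D * R2 + 10 * (2 * R2) = (D + 20) * R2 by ring.
    rewrite mulrA; apply: ler_wpM2l => //.
    by rewrite mulr_ge0 ?sqr_ge0 // addr_ge0.
  have -> : (2 * t * rho ^+ 2)^-1 * ((t * e) ^+ 2 * (D + 20) *
      (D ^+ 2 * (rho ^+ 2 * (1 + e))) * vol (@osimplex R d t)) =
      D * (t / 2) * ((D * e) * ((D + 20) * e) * (1 + e)) * vol (@osimplex R d t).
    by field; rewrite !gt_eqF.
  rewrite ler_wpM2r // ler_wpM2l ?mulr_ge0 ?divr_ge0 ?(ltW t0) //.
  have -> : D * e = 1 + e by rewrite -(natr1 d) mulrDl dd mul1r.
  have -> : (D + 20) * e = 1 + 21 * e.
    by rewrite -(natr1 d) -addrA mulrDl dd (_ : 1 + 20 = 21) //; ring.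
  (* The constant 50 suits e <= 1/2: at e = 1/2 the product is 25.875, against 26. *)
  nra.
have Hbr : D * (1 - rho ^+ 2 - t / 2) * vol (@osimplex R d t) -
    D * (t / 2) * (1 + 50 * e) * vol (@osimplex R d t) >= D * (e / 4) * vol (@osimplex R d t).
  rewrite -mulrBl ler_wpM2r // -[D * (t / 2) * _]mulrA -mulrBr ler_wpM2l //.
  have : (4 * d%:R)^-1 = e / 4 by rewrite invfM mulrC.
  move: Ht => /[swap] ->; lra.
have De : 1 <= D * e by rewrite -(natr1 d) mulrDl dd; lra.
rewrite -mulr_natl mulrA mulNr.
apply: (@le_trans _ _ (D * (e / 4) * vol (@osimplex R d t))); last by lra.
by have := ler_wpM2r v0 De; lra.
Qed.

(** Inside the unit ball the sum of the coordinates of z is at most <y, z> <= H, so the cone lies in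
    [facet V H]. In pivot coordinates this is a pyramid of height H, whose volume carries a factor
    1/(d+1) relative to its base, whereas the sectors together have volume at least a quarter of
    [osimplex d t]. This comparison produces the factor d. *)
Lemma simplex_density (rho gam t H : R) y : (1 < d)%N ->
  0 < rho -> rho < 1 -> 0 <= gam -> gam ^+ 2 = 1 - rho ^+ 2 -> 0 < t -> 0 < H ->
  (forall k, 1 <= inner y (row k V)) -> inner y y <= H ^+ 2 ->
  1 - H ^- 2 <= rho ^+ 2 * (1 + d%:R^-1) ->
  t * (1 + 25 / d%:R) + (4 * d%:R)^-1 <= 1 - rho ^+ 2 ->
  t ^+ d / (8 * expR 1 * H ^+ d.+1) * D * vol (kcone V `&` ball1 R d.+1) <=
  \sum_j vol (sector V j `&` capcone gam (row j V)).
Proof.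
move=> d1 r0 r1 g0 gE t0 H0 y1 yH Hr Ht.
have bsec j := rvbms_sector_capcone V j gam (row j V).
have bk := rvbms_kcone_ball V.
have uP j : pivot R j *m V \in unitmx by rewrite unitmx_mul pivot_unit.
have bf : rvbms (facet V H).
  have : rvbms [set x | pyramid H (x *m invmx (pivot R ord0 *m V))].
    by apply: rvbms_mul (rvbms_pyramid d H); rewrite unitmx_inv.
  congr rvbms; rewrite -(pivot_facet H ord0 uV).
  by apply/seteqP; split=> x /=; rewrite mulmxKV.
have vp := vol_pyramid_gt0 d H0.
have Hk j : exists2 k : R, 0 < k & vol (facet V H) * k = vol (@pyramid R d H) /\
   vol (sector V j `&` capcone gam (row j V)) * k =
   vol [set x | (sector V j `&` capcone gam (row j V)) (x *m (pivot R j *m V))].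
  have [k k0 Hk] := vol_lin (uP j).
  have Ef := Hk _ bf; rewrite (pivot_facet H j uV) in Ef.
  exists k; last by rewrite Hk // Ef !(mulrC k).
  by rewrite lt_neqAle k0 andbT eq_sym; apply: contraTneq vp => kE; rewrite Ef kE mul0r ltxx.
have vf : 0 < vol (facet V H).
  have [k k0 [E _]] := Hk ord0; by rewrite -(pmulr_lgt0 _ k0) E.
have kE j : vol (sector V j `&` capcone gam (row j V)) =
   vol [set x | (sector V j `&` capcone gam (row j V)) (x *m (pivot R j *m V))] *
     (vol (facet V H) / vol (@pyramid R d H)).
  have [k k0 [E1 <-]] := Hk j; rewrite -E1.
  by field; rewrite !gt_eqF.
rewrite (eq_bigr _ (fun j _ => kE j)) -mulr_suml.
apply: le_trans (_ : vol (@osimplex R d t) / 4 * (vol (facet V H) / vol (@pyramid R d H)) <= _);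
  last first.
  rewrite ler_wpM2r ?divr_ge0 ?vol_ge0 //.
  exact: (sum_vol_sector_ge d1 r0 r1 g0 gE t0 H0 y1 yH Hr Ht).
have sKF : vol (kcone V `&` ball1 R d.+1) <= vol (facet V H).
  apply: le_vol => // z [z0 z1]; split=> //.
  have zE : z = \sum_k (z *m invmx V) 0 k *: row k V by rewrite -mulmx_sum_row mulmxKV.
  apply: (@le_trans _ _ (inner y z)).
    rewrite [in X in _ <= X]zE inner_sumr; apply: ler_sum => k _.
    by rewrite innerZr ler_peMr // z0.
  have [yz|yz] := leP (inner y z) 0; first exact: le_trans yz (ltW H0).
  rewrite -(@ler_pXn2r _ 2) ?nnegrE ?(ltW H0) ?(ltW yz) //.
  apply: le_trans (cauchy_schwarz _ _) _; apply: le_trans yH.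
  by rewrite ler_piMr // inner_ge0.
rewrite vol_osimplex //.
have d0 : (0 < d)%N by exact: ltnW.
have pB : vol (@pyramid R d H) <= 2 * H ^+ d.+1 / D * (expR 1 * vol (@osimplex R d 1)).
  apply: le_trans (vol_pyramid_le d H0) _; rewrite ler_wpM2l ?vol_csimplex_le //.
  by rewrite divr_ge0 // mulr_ge0 // exprn_ge0 // ltW.
have vs1 : 0 < vol (@osimplex R d 1) by exact: vol_osimplex_gt0.
have c0 : 0 <= t ^+ d / (8 * expR 1 * H ^+ d.+1) * D.
  rewrite mulr_ge0 // divr_ge0 ?exprn_ge0 ?(ltW t0) //.
  by rewrite !mulr_ge0 ?expR_ge0 // exprn_ge0 // ltW.
apply: (@le_trans _ _ (t ^+ d / (8 * expR 1 * H ^+ d.+1) * D * vol (facet V H))).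
  exact: ler_wpM2l.
rewrite [leRHS]mulrA [leRHS]mulrAC ler_wpM2r ?(ltW vf) //.
rewrite ler_pdivlMr //.
apply: (@le_trans _ _ (t ^+ d / (8 * expR 1 * H ^+ d.+1) * D *
   (2 * H ^+ d.+1 / D * (expR 1 * vol (@osimplex R d 1))))).
  exact: ler_wpM2l.
have e0 := expR_gt0 (1 : R).
have HD : 0 < H ^+ d.+1 by rewrite exprn_gt0.
have DD : D != 0 by rewrite pnatr_eq0.
move: c0 pB; move: (H ^+ d.+1) HD (D) DD => h h0 D' D0 _ _.
rewrite le_eqVlt; apply/orP; left; apply/eqP; field.
by rewrite D0 !gt_eqF.
Qed.

End simplex_density.


(** * The triangulation and the covering bound *)

Section generic_costs.
Context (R : realType) (D n : nat) (x : 'I_n -> 'rV[R]_D).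
Implicit Types (S : {set 'I_n}) (y w z : 'rV[R]_D).

Definition xmx S : 'M[R]_(#|S|, D) := \matrix_k x (enum_val k).

Lemma mul_xmx S (v : 'rV[R]_#|S|) : v *m xmx S = \sum_k v 0 k *: x (enum_val k).
Proof. by rewrite mulmx_sum_row; apply: eq_bigr => k _; rewrite rowK. Qed.

(* With costs [1 + s^(i+1)], a linear relation between the [x i], [i \in S], that
   carries over to the costs makes [s] a root of a fixed nonzero polynomial. *)
Definition cost (s : R) (i : 'I_n) : R := 1 + s ^+ i.+1.

Definition relpoly S (v : 'rV[R]_#|S|) : {poly R} := \sum_k v 0 k *: (1 + 'X^((enum_val k).+1)).

Lemma relpoly_neq0 S (v : 'rV[R]_#|S|) : v != 0 -> relpoly v != 0.
Proof.
apply: contraNneq => p0; apply/eqP/rowP => k; rewrite mxE.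
have := congr1 (fun p : {poly R} => p`_(enum_val k).+1) p0.
rewrite coef0 coef_sum (bigD1 k) //= coefZ coefD coef1 coefXn eqxx add0r mulr1.
rewrite big1 ?addr0 // => l lk; rewrite coefZ coefD coef1 coefXn eqSS add0r.
case: eqP => [/val_inj/enum_val_inj kl|_]; last by rewrite mulr0.
by rewrite kl eqxx in lk.
Qed.

Lemma relpoly_root S (v : 'rV[R]_#|S|) s y : v *m xmx S = 0 ->
  (forall i, i \in S -> inner y (x i) = cost s i) -> root (relpoly v) s.
Proof.
move=> v0 Hy; apply/rootP; rewrite horner_sum.
transitivity (inner y (v *m xmx S)); last by rewrite v0 inner0r.
rewrite mul_xmx inner_sumr; apply: eq_bigr => k _.
by rewrite innerZr Hy ?enum_valP // !hornerE.
Qed.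

(** The points e/(k+1) with k below [size p] are too many to be roots all together. *)
Lemma exists_non_root (p : {poly R}) (e : R) : p != 0 -> 0 < e ->
  exists2 s, 0 < s <= e & ~~ root p s.
Proof.
move=> p0 e0; apply: contrapT => H.
pose rs := [seq e / k.+1%:R | k <- iota 0 (size p)].
have rsr : all (root p) rs.
  apply/allP => _ /mapP[k _ ->]; apply: contrapT => /negP nr; apply: H.
  exists (e / k.+1%:R) => //; rewrite divr_gt0 //= ler_pdivrMr // ler_peMr ?(ltW e0) //.
  by rewrite ler1n.
have urs : uniq rs.
  rewrite map_inj_uniq ?iota_uniq // => k l /(mulfI (lt0r_neq0 e0)) /invr_inj /eqP.
  by rewrite eqr_nat => /eqP[].
by have := max_poly_roots p0 rsr urs; rewrite size_map size_iota ltnn.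
Qed.

(** No degenerate vertex: constraints <y, x_i> <= c_i that are tight at a common point have
    independent vectors x_i. *)
Definition generic (c : 'I_n -> R) := forall S y,
  (forall i, i \in S -> inner y (x i) = c i) -> row_free (xmx S).

Lemma exists_generic (e : R) : 0 < e -> e <= 1 ->
  exists2 c, generic c & forall i, 1 <= c i <= 1 + e.
Proof.
move=> e0 e1.
have HS S : exists p : {poly R}, p != 0 /\ (~~ row_free (xmx S) ->
    forall s y, (forall i, i \in S -> inner y (x i) = cost s i) -> root p s).
  have [f|] := boolP (row_free (xmx S)); first by exists 1; rewrite oner_eq0.
  rewrite -kermx_eq0 => k0.
  have [k] : exists k, row k (kermx (xmx S)) != 0.
    apply: contrapT => /forallNP H; move/eqP: k0; apply; apply/row_matrixP => k.
    by rewrite row0; apply/eqP; apply: contrapT => /negP; exact: H.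
  move=> {}k0; exists (relpoly (row k (kermx (xmx S)))); split; first exact: relpoly_neq0.
  move=> _ s y Hy; apply: relpoly_root Hy.
  by rewrite -row_mul mulmx_ker row0.
have [p Hp] := choice HS.
(* A non-root of the product serves all the finitely many index sets at once. *)
have P0 : \prod_S p S != 0 by apply/prodf_neq0 => S _; have [] := Hp S.
have [s /andP[s0 se] sr] := exists_non_root P0 e0.
exists (cost s) => [S y Hy|i]; last first.
  rewrite /cost lerDl exprn_ge0 ?(ltW s0) //= lerD2l.
  apply: le_trans (se); rewrite exprS ler_piMr ?(ltW s0) //.
  by rewrite exprn_ile1 ?(ltW s0) // (le_trans se e1).
apply: contrapT => /negP nf; have [_ /(_ nf s y Hy) rp] := Hp S.
move: sr; rewrite /root horner_prod => /negP; apply; apply/prodf_eq0.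
by exists S.
Qed.

End generic_costs.

(** * Simplicial cones from a linear program *)

Section delaunay.
Context (R : realType) (D n : nat) (x : 'I_n -> 'rV[R]_D) (c : 'I_n -> R) (gam : R).
Implicit Types (S : {set 'I_n}) (y w z : 'rV[R]_D).
Hypothesis gam0 : 0 < gam.
Hypothesis cov : forall w, exists i, gam * Num.sqrt (inner w w) <= inner w (x i).
Hypothesis cgen : generic x c.
Hypothesis c0 : forall i, 0 <= c i.

(** Maximizing <y, z> over this polytope is the dual of writing z as a nonnegative combination of
    the x_i at least cost. The constraints tight at an optimal vertex give the cone that contains
    z. *)
Definition feasible y := forall i, inner y (x i) <= c i.
Definition active y : {set 'I_n} := [set i | inner y (x i) == c i].
Definition spanning S := forall w, (forall i, i \in S -> inner w (x i) = 0) -> w = 0.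

Lemma cov_pos w : w != 0 -> exists i, 0 < inner w (x i).
Proof.
move=> w0; have [i Hi] := cov w; exists i; apply: lt_le_trans Hi.
by rewrite mulr_gt0 // sqrtr_gt0 inner_gt0.
Qed.

(** While the tight vectors do not span, move orthogonally to them in a direction that does not
    decrease <., z>, until another constraint becomes tight. [cov_pos] guarantees that one does, and
    the number of tight constraints grows at each move. *)
Lemma spanning_ascent y z : feasible y ->
  exists y', [/\ feasible y', spanning (active y') & inner y z <= inner y' z].
Proof.
have [k] := ubnP (n - #|active y|); elim: k y => // k IH y; rewrite ltnS => Hk fy.
have [sp|] := pselect (spanning (active y)); first by exists y.
move=> /existsNP[w0 /not_implyP[Hw0 /eqP w0n]].
have [w [wn Hw wz]] : exists w, [/\ w != 0, forall i, i \in active y -> inner w (x i) = 0 &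
    0 <= inner w z].
  have [h|h] := leP 0 (inner w0 z); first by exists w0.
  exists (- w0); rewrite oppr_eq0 innerNl oppr_ge0 (ltW h); split=> // i /Hw0.
  by rewrite innerNl => ->; rewrite oppr0.
have [i0 Hi0] := cov_pos wn.
pose ratio i := (c i - inner y (x i)) / inner w (x i).
case: (@arg_minP _ _ _ i0 (fun i => 0 < inner w (x i)) ratio Hi0) => i1 wi1 Hmin.
have r0 : 0 <= ratio i1 by rewrite divr_ge0 ?(ltW wi1) // subr_ge0.
pose y' := y + ratio i1 *: w.
have y'E i : inner y' (x i) = inner y (x i) + ratio i1 * inner w (x i).
  by rewrite innerDl innerZl.
have fy' : feasible y'.
  move=> i; rewrite y'E; have [h|h] := leP (inner w (x i)) 0.
    rewrite -[X in _ <= X]addr0 lerD ?fy // mulr_ge0_le0 //.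
  have := Hmin _ h; rewrite /ratio -/(ratio i1) => hr.
  by rewrite -lerBrDl -ler_pdivlMr.
have yy' : (#|active y| < #|active y'|)%N.
  apply: proper_card; apply/properP; split.
    by apply/fintype.subsetP => i ai; rewrite inE y'E Hw // mulr0 addr0; rewrite inE in ai.
  exists i1; first by rewrite inE y'E divfK ?(gt_eqF wi1) // subrKC.
  by apply/negP => /Hw h; rewrite h ltxx in wi1.
have [|y2 [f2 s2 z2]] := IH y' _ fy'.
  have : (#|active y'| <= n)%N by rewrite -[X in (_ <= X)%N]card_ord max_card.
  by move=> h; apply: leq_trans Hk; rewrite ltn_sub2l // (leq_trans yy').
exists y2; split=> //; apply: le_trans z2.
by rewrite innerDl innerZl lerDl mulr_ge0.
Qed.

Lemma spanning_uniq S y y' : spanning S ->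
  (forall i, i \in S -> inner y (x i) = inner y' (x i)) -> y = y'.
Proof.
move=> sp H; apply/eqP; rewrite -subr_eq0; apply/eqP; apply: sp => i iS.
by rewrite innerDl innerNl H // subrr.
Qed.

(** No compactness is used: a vertex is determined by its active set, so there are finitely many
    vertices, and every feasible point is dominated by one of them. *)
Lemma exists_best_vertex z : exists y, [/\ feasible y, spanning (active y) &
  forall y', feasible y' -> inner y' z <= inner y z].
Proof.
pose vert S := `[< exists y, [/\ feasible y, spanning S & active y = S] >].
pose yS S := xget 0 [set y | [/\ feasible y, spanning S & active y = S]].
have ySP S : vert S -> [/\ feasible (yS S), spanning S & active (yS S) = S].
  by move=> /asboolP[y Hy]; rewrite /yS; case: xgetP => [y' _ []|/(_ y)].
have f0 : feasible 0 by move=> i; rewrite inner0l.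
have toS y : feasible y -> exists2 S, vert S & inner y z <= inner (yS S) z.
  move=> /(@spanning_ascent _ z)[y' [fy' sy' yz]]; exists (active y').
    by apply/asboolP; exists y'.
  have vS : vert (active y') by apply/asboolP; exists y'.
  have [_ _ aE] := ySP _ vS.
  suff -> : yS (active y') = y' by [].
  apply: (spanning_uniq sy') => i ia.
  have : i \in active (yS (active y')) by rewrite aE.
  by move: ia; rewrite !inE => /eqP-> /eqP->.
have [S0 vS0 _] := toS _ f0.
case: (@arg_maxP _ _ _ S0 vert (fun S => inner (yS S) z) vS0) => S vS Smax.
have [fS sS aS] := ySP _ vS.
exists (yS S); rewrite aS; split=> // y' /toS[S' vS' h].
by apply: le_trans h _; exact: Smax.
Qed.

Lemma spanning_card y : spanning (active y) -> #|active y| = D.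
Proof.
move=> sp; have fr : row_free (xmx x (active y)).
  by apply: (cgen (y := y)) => i; rewrite inE => /eqP.
have ff : row_free (xmx x (active y))^T.
  rewrite -kermx_eq0; apply/eqP/row_matrixP => k; rewrite row0; apply: sp => i ia.
  have /matrixP/(_ k (enum_rank_in ia i)) := mulmx_ker (xmx x (active y))^T.
  rewrite !mxE => <-; apply: eq_bigr => l _.
  by rewrite !mxE enum_rankK_in.
by move/eqP: fr; move/eqP: ff; rewrite mxrank_tr => -> ->.
Qed.

Definition vmx (f : {ffun 'I_D -> 'I_n}) : 'M[R]_D := \matrix_k x (f k).

(** Sortedness picks one enumeration of each tight set, so that a cone is counted once. The last
    clause says that nothing else is tight at the vertex. *)
Definition cell (f : {ffun 'I_D -> 'I_n}) := `[< [/\ sorted ltn [seq val (f k) | k <- enum 'I_D],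
  vmx f \in unitmx & exists y, [/\ feasible y, forall k, inner y (x (f k)) = c (f k) &
     forall i, inner y (x i) = c i -> exists k, i = f k]] >].

Lemma cell_cover z : exists2 f, cell f & forall k, 0 <= (z *m invmx (vmx f)) 0 k.
Proof.
have [y [fy sp ymax]] := exists_best_vertex z.
have cS := spanning_card sp.
pose f : {ffun 'I_D -> 'I_n} := [ffun k => enum_val (cast_ord (esym cS) k)].
have fin k : f k \in active y by rewrite ffunE enum_valP.
have fsur i : i \in active y -> exists k, i = f k.
  move=> ia; exists (cast_ord cS (enum_rank_in ia i)).
  by rewrite ffunE cast_ordK enum_rankK_in.
have fsort : sorted ltn [seq val (f k) | k <- enum 'I_D].
  have -> : [seq val (f k) | k <- enum 'I_D] = [seq val i | i <- enum (active y)].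
    have sD : size [seq val (f k) | k <- enum 'I_D] = D.
      exact: etrans (size_map _ _) (size_enum_ord D).
    apply: (@eq_from_nth _ 0%N) => [|k]; first by rewrite sD size_map -cardE cS.
    rewrite sD => kD; have n0 : 'I_n by exact: (f (Ordinal kD)).
    have kD' : (k < size (enum 'I_D))%N by apply: leq_trans kD _; rewrite -{1}sD size_map.
    rewrite (nth_map (Ordinal kD)) // (nth_map n0) -?cardE ?cS //.
    congr val; rewrite ffunE (enum_val_nth n0) /=; congr (nth _ _ _).
    exact: nth_enum_ord.
  rewrite sorted_map.
  have : sorted (relpre val ltn) (enum 'I_n).
    by rewrite -sorted_map val_enum_ord iota_ltn_sorted.
  rewrite {2}/enum_mem -enumT => h; apply: sorted_filter => //.
  by move=> a b d; exact: ltn_trans.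
have vU : vmx f \in unitmx.
  rewrite -unitmx_tr; apply: row_inj_unitmx => w w0; apply: sp => i /fsur[k ->].
  have := congr1 (fun M : 'rV_D => M 0 k) w0; rewrite mxE mxE => <-.
  by apply: eq_bigr => l _; rewrite !mxE.
exists f.
  apply/asboolP; split=> //; exists y; split=> // [k|i h].
    by have := fin k; rewrite inE => /eqP.
  by apply: fsur; rewrite inE h.
move=> k; rewrite leNgt; apply/negP => lk.
(* Minus a dual basis vector: moving along [w] loosens constraint k, keeps the other active ones
   tight and, since the k-th coordinate of z is negative, increases <., z>, against optimality. *)
pose w : 'rV[R]_D := - (col k (invmx (vmx f)))^T.
have wE l : inner w (x (f l)) = - (l == k)%:R.
  rewrite innerNl; congr (- _).
  have /matrixP/(_ l k) := mulmxV vU; rewrite !mxE => <-.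
  by apply: eq_bigr => m _; rewrite !mxE mulrC.
have wz : 0 < inner w z.
  have zE : z = \sum_l (z *m invmx (vmx f)) 0 l *: x (f l).
    rewrite -[LHS](mulmxKV vU) mulmx_sum_row; apply: eq_bigr => l _.
    by rewrite rowK.
  rewrite zE inner_sumr (bigD1 k) //= big1 => [|l lk']; last first.
    by rewrite innerZr wE (negbTE lk') oppr0 mulr0.
  by rewrite addr0 innerZr wE eqxx mulrN1 oppr_gt0.
pose slack i := c i - inner y (x i).
(* A step short enough for all inactive constraints; the active ones have slack 0 and contribute 0,
   since division by 0 gives 0. *)
pose s := (1 + \sum_i `|inner w (x i)| / `|slack i|)^-1.
have sum0 : 0 <= \sum_i `|inner w (x i)| / `|slack i|.
  by apply: sumr_ge0 => i _; rewrite divr_ge0.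
have s0 : 0 < s by rewrite invr_gt0 ltr_wpDr.
have fy' : feasible (y + s *: w).
  move=> i; rewrite innerDl innerZl.
  have [/fsur[l ->]|ia] := boolP (i \in active y).
    rewrite wE -[X in _ <= X]addr0 lerD ?fy // mulrN oppr_le0 mulr_ge0 // ltW //.
  have sl0 : 0 < slack i.
    by rewrite subr_gt0 lt_neqAle fy andbT; move: ia; rewrite inE.
  rewrite -lerBrDl -/(slack i) /s ler_pdivrMl ?ltr_wpDr //.
  apply: le_trans (ler_norm _) _; rewrite -ler_pdivrMr // (bigD1 i) //=.
  rewrite (gtr0_norm sl0) addrCA lerDl addr_ge0 //.
  by apply: sumr_ge0 => l _; rewrite divr_ge0.
have := ymax _ fy'; rewrite innerDl innerZl gerDl leNgt mulr_gt0 //.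
Qed.

Lemma mul_vmx z f : vmx f \in unitmx -> z = \sum_k (z *m invmx (vmx f)) 0 k *: x (f k).
Proof.
move=> uf; rewrite -[LHS](mulmxKV uf) mulmx_sum_row; apply: eq_bigr => l _.
by rewrite rowK.
Qed.

(* Weak duality with its equality case. *)
Lemma feasible_le z g y y' : vmx g \in unitmx -> feasible y ->
  (forall k, inner y' (x (g k)) = c (g k)) ->
  (forall k, 0 < (z *m invmx (vmx g)) 0 k) ->
  inner y z <= inner y' z /\
  (inner y' z <= inner y z -> forall k, inner y (x (g k)) = c (g k)).
Proof.
move=> ug fy yg zg; set mu := z *m _ in zg.
have E : inner y' z - inner y z = \sum_k mu 0 k * (c (g k) - inner y (x (g k))).
  rewrite {1 2}(mul_vmx z ug) !inner_sumr -sumrB; apply: eq_bigr => k _.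
  by rewrite !innerZr yg mulrBr.
have p0 k : true -> 0 <= mu 0 k * (c (g k) - inner y (x (g k))).
  by move=> _; rewrite mulr_ge0 ?(ltW (zg k)) // subr_ge0.
split; first by rewrite -subr_ge0 E; exact: sumr_ge0.
rewrite -subr_le0 E => h k.
have /eqP := psumr_eq0P p0 (le_anti (introT andP (conj h (sumr_ge0 _ p0)))) (i := k) isT.
by rewrite mulf_eq0 (gt_eqF (zg k)) subr_eq0 => /eqP.
Qed.

(** By [feasible_le] in both directions the two vertices give the same value at z. The equality case
    makes each vertex tight on the other cell, so the active sets coincide, and so do their
    increasing enumerations. *)
Lemma cell_disjoint f g z : cell f -> cell g ->
  (forall k, 0 < (z *m invmx (vmx f)) 0 k) ->
  (forall k, 0 < (z *m invmx (vmx g)) 0 k) -> f = g.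
Proof.
move=> /asboolP[sf uf [y [fy yf yf']]] /asboolP[sg ug [y' [fy' yg yg']]] zf zg.
have [h1 h2] := feasible_le ug fy yg zg.
have [h3 h4] := feasible_le uf fy' yf zf.
have fg k : exists l, f k = g l by apply: yg'; exact: h4.
have gf k : exists l, g k = f l by apply: yf'; exact: h2.
have : [seq val (f k) | k <- enum 'I_D] = [seq val (g k) | k <- enum 'I_D].
  apply: (irr_sorted_eq ltn_trans ltnn sf sg) => i.
  apply/mapP/mapP => -[k _ ->]; first by have [l ->] := fg k; exists l; rewrite ?mem_enum.
  by have [l ->] := gf k; exists l; rewrite ?mem_enum.
move/eq_in_map => H; apply/ffunP => k; apply: val_inj; apply: H.
by rewrite mem_enum.
Qed.

Lemma cell_unit f : cell f -> vmx f \in unitmx.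
Proof. by move=> /asboolP[]. Qed.

(** The covering hypothesis is applied to the vertex y itself: some x_i has gam |y| <= <y, x_i> <= 1
    + e. This is the dual form of the bound on the circumradius. *)
Lemma cell_dual f e : 0 <= e -> (forall i, 1 <= c i <= 1 + e) -> cell f ->
  exists y, (forall k, 1 <= inner y (row k (vmx f))) /\ inner y y <= ((1 + e) / gam) ^+ 2.
Proof.
move=> e0 ce /asboolP[_ _ [y [fy yf _]]]; exists y; split=> [k|].
  by rewrite rowK yf; have /andP[] := ce (f k).
have [i Hi] := cov y.
rewrite -(sqr_sqrtr (inner_ge0 y)); apply: lerXn2r; rewrite ?nnegrE ?sqrtr_ge0 //.
  by rewrite divr_ge0 ?(ltW gam0) // addr_ge0.
rewrite ler_pdivlMr // mulrC; apply: le_trans Hi _; apply: le_trans (fy i) _.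
by have /andP[] := ce i.
Qed.

End delaunay.

(** * Density of a covering by caps *)

Section covering.
Context (R : realType) (d n : nat) (x : 'I_n -> 'rV[R]_d.+1).
Hypothesis x1 : forall i, inner (x i) (x i) = 1.

(** Why sectors at one point are disjoint: a large multiple of that point carries elements of its
    sectors into the interiors of the corresponding cones, where [cell_disjoint] applies. *)
Lemma sector_shift f j z N : vmx x f \in unitmx -> sector (vmx x f) j z ->
  - (z *m invmx (vmx x f)) 0 j < N ->
  forall k, 0 < ((z + N *: x (f j)) *m invmx (vmx x f)) 0 k.
Proof.
move=> uf sz hN k.
have -> : x (f j) = delta_mx 0 j *m vmx x f by rewrite -rowE rowK.
rewrite mulmxDl -scalemxAl mulmxK // mxE [X in _ + X]mxE [X in _ * X]mxE eqxx /=.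
have [->|kj] := eqVneq k j; first by rewrite mulr1 -ltrBlDl sub0r.
by rewrite mulr0 addr0; exact: sz.
Qed.

Theorem covering_density (rho gam t e : R) : (1 < d)%N ->
  0 < rho -> rho < 1 -> 0 < gam -> gam ^+ 2 = 1 - rho ^+ 2 -> 0 < t ->
  0 < e -> e <= 1 ->
  1 - ((1 + e) / gam) ^- 2 <= rho ^+ 2 * (1 + d%:R^-1) ->
  t * (1 + 25 / d%:R) + (4 * d%:R)^-1 <= 1 - rho ^+ 2 ->
  (forall w, exists i, gam * Num.sqrt (inner w w) <= inner w (x i)) ->
  t ^+ d / (8 * expR 1 * ((1 + e) / gam) ^+ d.+1) * d.+1%:R * vol (ball1 R d.+1) <=
  \sum_i vol (capcone gam (x i)).
Proof.
move=> d1 r0 r1 g0 gE t0 e0 e1 Hr Ht cov.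
have [c cg ce] := exists_generic x e0 e1.
have c0 i : 0 <= c i by have /andP[h _] := ce i; apply: le_trans h.
pose F := {ffun 'I_d.+1 -> 'I_n}.
pose K := t ^+ d / (8 * expR 1 * ((1 + e) / gam) ^+ d.+1) * d.+1%:R.
have H0 : 0 < (1 + e) / gam by rewrite divr_gt0 // addr_gt0.
have K0 : 0 <= K.
  rewrite mulr_ge0 // divr_ge0 ?exprn_ge0 ?(ltW t0) //.
  by rewrite !mulr_ge0 ?expR_ge0 // exprn_ge0 // ltW.
rewrite -/K; apply: (@le_trans _ _ (\sum_(f : F | cell x c f) K * vol (kcone (vmx x f) `&` ball1 R d.+1))).
  rewrite -mulr_sumr ler_wpM2l // -big_filter; apply: vol_le_sum.
  - by move=> f; exact: rvbms_kcone_ball.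
  - exact: rvbms_ball1.
  move=> z z1; have [f cf zf] := cell_cover g0 cov cg c0 z.
  by exists f => //; rewrite mem_filter cf mem_index_enum.
apply: (@le_trans _ _ (\sum_(f : F | cell x c f) \sum_j
   vol (sector (vmx x f) j `&` capcone gam (row j (vmx x f))))).
  apply: ler_sum => f cf; have [y [y1 y2]] := cell_dual g0 cov (ltW e0) ce cf.
  apply: (@simplex_density _ _ _ _ _ rho _ _ _ y) => //; last exact: ltW.
  - exact: cell_unit cf.
  - by move=> k; rewrite rowK.
(* The pairs of a cell and one of its vertices are regrouped by the point at that vertex, to be
   compared with a single cap. *)
rewrite pair_big_dep /=.
rewrite (partition_big (fun p : F * 'I_d.+1 => p.1 p.2) xpredT) //=.
apply: ler_sum => i _; rewrite -big_filter.
apply: vol_sum_le.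
- by move=> p _; exact: rvbms_sector_capcone.
- exact: rvbms_capcone.
- by rewrite filter_uniq // index_enum_uniq.
- by move=> p; rewrite mem_filter => /andP[/andP[_ /eqP <-] _] z [_]; rewrite rowK.
move=> [f j] [g k] z; rewrite !mem_filter /= !andbT.
move=> /andP[/andP[cf /eqP fj] _] /andP[/andP[cg' /eqP gk] _] [zf _] [zg _].
pose N := 1 + `|(z *m invmx (vmx x f)) 0 j| + `|(z *m invmx (vmx x g)) 0 k|.
have fg : f = g.
  apply: (@cell_disjoint _ _ _ x c _ _ (z + N *: x i)) => //.
    rewrite -fj; apply: sector_shift => //; first exact: cell_unit cf.
    apply: le_lt_trans (ler_norm _) _; rewrite normrN /N.
    by have := normr_ge0 ((z *m invmx (vmx x g)) 0 k); lra.
  rewrite -gk; apply: sector_shift => //; first exact: cell_unit cg'.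
  apply: le_lt_trans (ler_norm _) _; rewrite normrN /N.
  by have := normr_ge0 ((z *m invmx (vmx x f)) 0 j); lra.
congr pair => //.
have uf := cell_unit cf; rewrite -fg in gk.
have vE l : delta_mx 0 l = x (f l) *m invmx (vmx x f).
  by rewrite -(mulmxK uf (delta_mx 0 l)) -rowE rowK.
have /rowP/(_ j) : delta_mx 0 j = delta_mx 0 k :> 'rV[R]_d.+1 by rewrite !vE fj gk.
rewrite !mxE !eqxx /=; case: eqP => // _ /eqP.
by rewrite oner_eq0.
Qed.

End covering.


(** * Spherical caps *)

Section cap_cone.
Context (R : realType) (d : nat).
Implicit Types (x y z v w : 'rV[R]_d.+1).

Lemma sphereE x : sphere R d x <-> inner x x = 1.
Proof.
rewrite /sphere /=; split=> [h|->]; last by rewrite sqrtr1.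
by rewrite -(sqr_sqrtr (inner_ge0 x)) h expr1n.
Qed.

Lemma inner_normalize z : z != 0 ->
  inner ((Num.sqrt (inner z z))^-1 *: z) ((Num.sqrt (inner z z))^-1 *: z) = 1.
Proof.
move=> z0; rewrite innerZl innerZr mulrA -expr2 exprVn sqr_sqrtr ?inner_ge0 //.
by rewrite mulVf // inner_eq0.
Qed.

Lemma normalizeK z : z != 0 ->
  z = Num.sqrt (inner z z) *: ((Num.sqrt (inner z z))^-1 *: z).
Proof.
by move=> z0; rewrite scalerA divff ?scale1r // gt_eqF // sqrtr_gt0 inner_gt0.
Qed.

Lemma cone_sphere : cone (sphere R d) = ball1 R d.+1.
Proof.
apply/seteqP; split=> z.
  move=> [t [a /sphereE a1 [/andP[t0 t1] ->]]].
  by rewrite /ball1 /= innerZl innerZr a1 mulr1 -expr2 expr_le1.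
rewrite /ball1 /= => z1; have [->|z0] := eqVneq z 0.
  exists 0; exists ('e_0 : 'rV[R]_d.+1); last by rewrite lexx ler01 scale0r.
  apply/sphereE; rewrite /inner (bigD1 0) //= mxE !eqxx mulr1 big1 ?addr0 // => i i0.
  by rewrite !mxE (negbTE i0) andbF mulr0.
exists (Num.sqrt (inner z z)); exists ((Num.sqrt (inner z z))^-1 *: z).
  by apply/sphereE; exact: inner_normalize.
split; last exact: normalizeK.
by rewrite sqrtr_ge0 /= -sqrtr1 ler_sqrt.
Qed.

Lemma inner_unit x y : inner x x = 1 -> inner y y = 1 -> -1 <= inner x y <= 1.
Proof.
move=> x1 y1; have := cauchy_schwarz x y; rewrite x1 y1 mulr1 => h.
by rewrite -ler_norml -(@ler_pXn2r _ 2) ?nnegrE // real_normK ?num_real // expr1n.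
Qed.

Lemma acos_le (a b : R) : -1 <= a <= 1 -> -1 <= b <= 1 -> (acos a <= acos b) = (b <= a).
Proof.
move=> ha hb; rewrite -[in RHS](acosK (x := a)) ?in_itv //= -[in RHS](acosK (x := b)) ?in_itv //=.
rewrite -[LHS]negbK -[RHS]negbK -!ltNge ltr_cos // in_itv /= acos_ge0 ?acos_lepi //.
Qed.

Lemma cap_acosE x gam y : inner x x = 1 -> -1 <= gam <= 1 ->
  cap x (acos gam) y <-> inner y y = 1 /\ gam <= inner x y.
Proof.
move=> x1 hg; rewrite /cap /=; split=> [[/sphereE y1]|[y1 h]].
  by rewrite acos_le // inner_unit.
by split; [exact/sphereE|rewrite acos_le // inner_unit].
Qed.

Lemma cone_cap x gam : inner x x = 1 -> 0 <= gam <= 1 -> cone (cap x (acos gam)) = capcone gam x.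
Proof.
move=> x1 /andP[g0 g1]; have hg : -1 <= gam <= 1 by rewrite g1 andbT; lra.
apply/seteqP; split=> z.
  move=> [t [a /(cap_acosE _ x1 hg)[a1 ga] [/andP[t0 t1] ->]]].
  rewrite /capcone /= !innerZl !innerZr a1 mulr1 -expr2 expr_le1 // t1; split=> //.
  by rewrite sqrtr_sqr ger0_norm // mulrC ler_wpM2l.
move=> [z1 gz]; have [->|z0] := eqVneq z 0.
  exists 0; exists x; last by rewrite lexx ler01 scale0r.
  by apply/(cap_acosE _ x1 hg); rewrite x1.
have s0 : 0 < Num.sqrt (inner z z) by rewrite sqrtr_gt0 inner_gt0.
exists (Num.sqrt (inner z z)); exists ((Num.sqrt (inner z z))^-1 *: z).
  apply/(cap_acosE _ x1 hg); split; first exact: inner_normalize.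
  by rewrite innerZr mulrC ler_pdivlMr.
split; last exact: normalizeK.
by rewrite sqrtr_ge0 /= -sqrtr1 ler_sqrt.
Qed.

Lemma vol_ball1_gt0 : 0 < vol (ball1 R d.+1).
Proof.
have [e e0 en] : exists2 e : R, 0 < e & d.+1%:R * e <= 1.
  by exists (d.+1%:R^-1); rewrite ?invr_gt0 // divff.
have e1 : e <= 1 by apply: le_trans en; rewrite ler_peMl ?(ltW e0) // ler1n.
apply: (@vol_gt0 _ _ _ (fun=> 0) (fun=> e)) => //; first exact: rvbms_ball1.
move=> x Hx; rewrite /ball1 /=; apply: le_trans en.
rewrite mulr_natl -[X in _ *+ X]card_ord -sumr_const; apply: ler_sum => i _.
have /andP[h1 h2] := Hx i; apply: le_trans (_ : x 0 i * 1 <= _); last by rewrite mulr1.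
by rewrite ler_wpM2l // (le_trans h2).
Qed.

Lemma sigma_cap x gam : inner x x = 1 -> 0 <= gam <= 1 ->
  sigma (cap x (acos gam)) = (vol (capcone gam x) / vol (ball1 R d.+1))%:E.
Proof.
move=> x1 hg; rewrite /sigma cone_cap // cone_sphere volE ?volE //.
- by rewrite inver gt_eqF ?vol_ball1_gt0.
- exact: rvbms_ball1.
- exact: rvbms_capcone.
Qed.

Definition reflection w : 'M[R]_d.+1 := 1%:M - (2 / inner w w) *: (w^T *m w).

Lemma mul_reflection w z : z *m reflection w = z - (2 * inner z w / inner w w) *: w.
Proof.
rewrite mulmxBr mulmx1 -scalemxAr mulmxA; congr (_ - _).
have -> : z *m w^T = (inner z w)%:M.
  by rewrite [LHS]mx11_scalar; congr _%:M; rewrite mxE; apply: eq_bigr => i _; rewrite mxE.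
by rewrite mul_scalar_mx scalerA; congr (_ *: _); ring.
Qed.

Lemma inner_reflection w z v : inner (z *m reflection w) (v *m reflection w) = inner z v.
Proof.
rewrite !mul_reflection; have [->|w0] := eqVneq w 0; first by rewrite !scaler0 !subr0.
rewrite innerDl !innerDr !innerNl !innerNr !innerZl !innerZr (innerC w v).
by field; rewrite inner_eq0.
Qed.

Lemma reflection_unit w : reflection w \in unitmx.
Proof.
apply: row_inj_unitmx => z z0; apply/eqP; rewrite -inner_eq0 -(inner_reflection w) z0.
by rewrite inner0l.
Qed.

Lemma vol_reflection w A : rvbms A -> vol [set z | A (z *m reflection w)] = vol A.
Proof.
move=> bA; have [k k0 Hk] := vol_lin (reflection_unit w).
rewrite Hk //; have := Hk _ (rvbms_ball1 R d.+1).
rewrite (_ : [set z | _] = ball1 R d.+1).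
  have := vol_ball1_gt0; move: (vol _) => b b0 h.
  have /eqP : (k - 1) * b = 0 by rewrite mulrBl mul1r -h subrr.
  by rewrite mulf_eq0 (gt_eqF b0) orbF subr_eq0 => /eqP->; rewrite mul1r.
by apply/seteqP; split=> z; rewrite /ball1 /= inner_reflection.
Qed.

(** The reflection along x - y exchanges the two unit vectors and preserves inner products; its
    volume factor is 1 because it preserves the ball. *)
Lemma vol_capcone_eq x y gam : inner x x = 1 -> inner y y = 1 ->
  vol (capcone gam x) = vol (capcone gam y).
Proof.
move=> x1 y1; rewrite -(vol_reflection (x - y)); last exact: rvbms_capcone.
congr vol; have xy : y *m reflection (x - y) = x.
  rewrite mul_reflection; have [E|xy] := eqVneq (x - y) 0.
    by rewrite E scaler0 subr0; apply/esym/eqP; rewrite -subr_eq0 E.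
  have n0 : inner (x - y) (x - y) != 0 by rewrite inner_eq0.
  have E : inner (x - y) (x - y) = - (2 * inner y (x - y)).
    by rewrite innerDl !innerDr !innerNl !innerNr x1 y1 (innerC x y); ring.
  have -> : 2 * inner y (x - y) / inner (x - y) (x - y) = - 1.
    by apply: (mulIf n0); rewrite divfK // E; ring.
  by rewrite scaleN1r opprK addrC subrK.
apply/seteqP; split=> z; rewrite /capcone /= inner_reflection => -[z1 h]; split=> //.
  by rewrite -(inner_reflection (x - y) y z) xy.
by move: h; rewrite -(inner_reflection (x - y) y z) xy.
Qed.

(** A cone about the first axis with a flat top, of height [h] and half-angle arctan [tau]. Unlike
    the cone over a cap, it has a volume that scales exactly in both parameters. *)
Definition vcone (tau h : R) : set 'rV[R]_d.+1 :=
  [set x | 0 <= rvhead x <= h /\ inner (rvtail x) (rvtail x) <= (tau * rvhead x) ^+ 2].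

Lemma inner_head_tail x y : inner x y = rvhead x * rvhead y + inner (rvtail x) (rvtail y).
Proof.
rewrite /inner big_ord_recl; congr (_ + _); apply: eq_bigr => i _; by rewrite !mxE.
Qed.

Lemma rvbms_vcone tau h : rvbms (vcone tau h).
Proof.
split.
  rewrite (_ : vcone tau h = [set x | 0 <= rvhead x] `&` ([set x | rvhead x <= h] `&`
     [set x | inner (rvtail x) (rvtail x) <= tau * rvhead x * (tau * rvhead x)])).
    have mh : rvfun (@rvhead R d) by exact: rvfun_head.
    have mth : rvfun (fun x : 'rV[R]_d.+1 => tau * rvhead x).
      by apply: rvfunM => //; exact: rvfun_cst.
    apply: rvsetI; first exact: (rvset_le (rvfun_cst _) mh).
    apply: rvsetI; first exact: (rvset_le mh (rvfun_cst _)).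
    by apply: rvset_le; [apply: rvfun_inner; exact: rvmap_tail|exact: rvfunM].
  apply/seteqP; split=> x; rewrite /vcone /= -expr2; first by move=> [/andP[]].
  by move=> [? [? ?]]; split=> //; apply/andP.
exists (`|h| + `|tau| * `|h|) => x i [/andP[h0 h1] hx].
have hh : `|rvhead x| <= `|h| by rewrite ger0_norm // ger0_norm // (le_trans h0).
case: (unliftP 0 i) => [j ->|->]; last first.
  by apply: le_trans hh _; rewrite lerDl mulr_ge0.
apply: (@le_trans _ _ (`|tau| * `|h|)); last by rewrite lerDr.
have := coord_le_norm (rvtail x) j; rewrite mxE => H; apply: le_trans H _.
apply: (@le_trans _ _ (Num.sqrt ((tau * rvhead x) ^+ 2))); first by rewrite ler_sqrt ?sqr_ge0.
by rewrite sqrtr_sqr normrM ler_wpM2l.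
Qed.

Lemma vol_vcone_height tau h : 0 < h -> vol (vcone tau h) = h ^+ d.+1 * vol (vcone tau 1).
Proof.
move=> h0; have hi : 0 < h^-1 by rewrite invr_gt0.
have := vol_scale hi (rvbms_vcone tau 1); rewrite invrK => <-; congr vol.
have E x : rvtail (h^-1 *: x) = h^-1 *: rvtail x by apply/rowP => j; rewrite !mxE.
apply/seteqP; split=> x; rewrite /vcone /= E innerZl innerZr /rvhead mxE => -[/andP[x0 x1] hx].
  split; first by rewrite mulr_ge0 ?(ltW hi) //= mulrC ler_pdivrMr // mul1r.
  rewrite mulrA -expr2 mulrCA [X in _ <= X]exprMn ler_wpM2l ?sqr_ge0 //.
move: x0 x1 hx; rewrite pmulr_rge0 // => -> x1.
rewrite mulrA -expr2 mulrCA [X in _ <= X]exprMn ler_pM2l ?exprn_gt0 // => ->; split=> //=.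
by move: x1; rewrite mulrC ler_pdivrMr // mul1r.
Qed.

Lemma vol_vcone_width tau : 0 < tau -> vol (vcone tau 1) = tau ^+ d * vol (vcone 1 1).
Proof.
move=> t0; have ti : 0 < tau^-1 by rewrite invr_gt0.
pose M : 'M[R]_d.+1 := diag_mx (rvcons 1 (const_mx tau^-1)).
have ME x : x *m M = rvcons (rvhead x) (tau^-1 *: rvtail x).
  apply/rowP => i; rewrite mul_mx_diag mxE; case: (unliftP 0 i) => [j ->|->].
    by rewrite !rvconsS !mxE mulrC.
  by rewrite !rvcons0 mulr1.
have uM : M \in unitmx.
  apply: row_inj_unitmx => x; rewrite ME => E.
  rewrite -(rvcons_eta x); have hE : rvhead x = 0.
    by rewrite -(rvhead_cons (rvhead x) (tau^-1 *: rvtail x)) E /rvhead mxE.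
  have tE : rvtail x = 0.
    have : tau^-1 *: rvtail x = 0.
      by rewrite -(rvtail_cons (rvhead x) (tau^-1 *: rvtail x)) E; apply/rowP => j; rewrite !mxE.
    by move/eqP; rewrite scaler_eq0 (gt_eqF ti) => /eqP.
  rewrite hE tE; apply/rowP => i; rewrite !mxE; case: unlift => // j; by rewrite mxE.
have [k k0 Hk] := vol_lin uM.
have kE : k = tau ^+ d.
  have := Hk _ (rvbms_box (fun=> 0) (fun=> 1)).
  rewrite vol_box // [X in k * X]big1 => [|l _]; last by rewrite subr0.
  rewrite mulr1 => <-.
  rewrite [X in vol X](_ : _ = box (fun=> 0) (fun i => if unlift ord0 i is Some _ then tau else 1)).
    rewrite vol_box => [|i]; last by case: unlift => *; rewrite ?ler01 // ltW.
    rewrite big_ord_recl unlift_none subr0 mul1r.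
    rewrite (eq_bigr (fun=> tau)) ?prodr_const ?card_ord // => i _.
    by rewrite liftK subr0.
  apply/seteqP; split=> x H i; have := H i; rewrite ME; case: (unliftP 0 i) => [j ->|->];
    rewrite ?rvconsS ?rvcons0 ?mxE ?unlift_none ?liftK //.
    by rewrite pmulr_rge0 // mulrC ler_pdivrMr // mul1r.
  by rewrite pmulr_rge0 // [tau^-1 * _]mulrC ler_pdivrMr // mul1r.
rewrite -kE -Hk; last exact: rvbms_vcone.
congr vol; apply/seteqP; split=> x; rewrite /vcone /= ME rvhead_cons rvtail_cons innerZl innerZr mul1r;
  move=> [h hx]; split=> //; move: hx; rewrite mulrA -expr2 exprVn exprMn;
  by rewrite ler_pdivrMl ?exprn_gt0.
Qed.

(** The ball of radius 1/4 centred on the axis at height 3/4 fits into the cone. *)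
Lemma vol_vcone_ge : vol (ball1 R d.+1) <= 4 ^+ d.+1 * vol (vcone 1 1).
Proof.
pose c : 'rV[R]_d.+1 := rvcons (3/4) 0.
have b4 := rvbms_scale (ltr0Sn R 3) (rvbms_ball1 R d.+1).
have : vol [set x | [set y | ball1 R d.+1 (4 *: y)] (- c + x)] <= vol (vcone 1 1).
  apply: le_vol; [exact: rvbms_trans|exact: rvbms_vcone|].
  move=> x; rewrite /ball1 /vcone /= innerZl innerZr inner_head_tail.
  have -> : rvtail (- c + x) = rvtail x.
    by apply/rowP => j; rewrite !mxE liftK mxE oppr0 add0r.
  have -> : rvhead (- c + x) = rvhead x - 3/4 by rewrite /rvhead mxE mxE rvcons0 addrC.
  have q0 := inner_ge0 (rvtail x); move: (inner _ _) (rvhead x) q0 => q a q0 h.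
  have h1 : (a - 3/4) ^+ 2 <= (1/4) ^+ 2 by rewrite expr2; nra.
  have h2 : q <= (1/4) ^+ 2.
    by have := sqr_ge0 (a - 3/4); rewrite expr2 => h3; nra.
  have : `|a - 3/4| <= 1/4.
    by rewrite -(@ler_pXn2r _ 2) ?nnegrE // real_normK ?num_real.
  rewrite ler_norml => /andP[a1 a2]; split; first by apply/andP; split; lra.
  apply: le_trans h2 _; apply: lerXn2r; rewrite ?nnegrE; lra.
rewrite vol_trans // vol_scale //; last exact: rvbms_ball1.
by rewrite exprVn ler_pdivrMl ?exprn_gt0.
Qed.

(** The round top lies between the flat tops at heights gam and 1, since within the cone the norm is
    at most the height divided by gam. *)
Lemma capcone_bounds x rho gam : inner x x = 1 -> 0 < gam -> 0 < rho -> gam ^+ 2 = 1 - rho ^+ 2 ->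
  gam ^+ d.+1 * (rho / gam) ^+ d * vol (vcone 1 1) <= vol (capcone gam x) <=
  (rho / gam) ^+ d * vol (vcone 1 1).
Proof.
move=> x1 g0 r0 gE; have t0 : 0 < rho / gam by rewrite divr_gt0.
pose e : 'rV[R]_d.+1 := rvcons 1 0.
have he : rvhead e = 1 by exact: rvhead_cons.
have te : rvtail e = 0 by exact: rvtail_cons.
have e1 : inner e e = 1 by rewrite inner_head_tail he te inner0l mul1r addr0.
have eE z : inner e z = rvhead z by rewrite inner_head_tail he te inner0l mul1r addr0.
rewrite (vol_capcone_eq gam x1 e1) -mulrA -vol_vcone_width // -vol_vcone_height //.
have tE : (rho / gam) ^+ 2 = (1 - gam ^+ 2) / gam ^+ 2
  by rewrite exprMn exprVn gE; congr (_ / _); ring.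
have g20 : 0 < gam ^+ 2 by rewrite exprn_gt0.
have key z : 0 <= rvhead z -> (gam * Num.sqrt (inner z z) <= rvhead z) =
    (inner (rvtail z) (rvtail z) <= (rho / gam * rvhead z) ^+ 2).
  move=> h0; rewrite -(@ler_pXn2r _ 2) // ?nnegrE ?mulr_ge0 ?sqrtr_ge0 ?(ltW g0) //.
  rewrite exprMn sqr_sqrtr ?inner_ge0 // (inner_head_tail z z) -expr2.
  rewrite [X in _ = (_ <= X)]exprMn tE [X in _ = (_ <= X)]mulrAC ler_pdivlMr // mulrDr mulrBl mul1r.
  by rewrite [_ * gam ^+ 2]mulrC lerBrDl.
apply/andP; split; apply: le_vol; try exact: rvbms_vcone; try exact: rvbms_capcone.
  move=> z [/andP[h0 h1] hz]; rewrite /capcone /= eE key //; split=> //.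
  rewrite inner_head_tail -expr2; apply: (@le_trans _ _ (rvhead z ^+ 2 / gam ^+ 2)).
    apply: (@le_trans _ _ (rvhead z ^+ 2 + (rho / gam * rvhead z) ^+ 2)); first by rewrite lerD2l.
    rewrite exprMn tE le_eqVlt; apply/orP; left; apply/eqP; field.
    by rewrite gt_eqF.
  rewrite ler_pdivrMr // mul1r; apply: lerXn2r; rewrite ?nnegrE //; exact: ltW.
move=> z [z1]; rewrite eE => hz.
have h0 : 0 <= rvhead z by apply: le_trans hz; rewrite mulr_ge0 ?sqrtr_ge0 // ltW.
split; last by rewrite -key.
rewrite h0 /= -(@ler_pXn2r _ 2) ?nnegrE // expr1n; apply: le_trans z1.
by rewrite inner_head_tail -expr2 lerDl inner_ge0.
Qed.

End cap_cone.


(** * Choice of the cap radius *)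

Section constants.
Context (R : realType).

Lemma expr_le_expR (a b : R) k : 0 <= a -> a <= expR b -> a ^+ k <= expR (b * k%:R).
Proof.
by move=> a0 ab; rewrite expRM_natr; apply: lerXn2r; rewrite ?nnegrE ?expR_ge0.
Qed.

Lemma expR_le_expr (a b : R) k : expR b <= a -> expR (b * k%:R) <= a ^+ k.
Proof.
move=> ab; rewrite expRM_natr; apply: lerXn2r; rewrite ?nnegrE ?expR_ge0 //.
by apply: le_trans ab; exact: expR_ge0.
Qed.

Lemma expRN2_le (X : R) : 0 <= X -> X <= 1/2 -> expR (- (2 * X)) <= 1 - X.
Proof.
move=> X0 X1; rewrite expRN invf_ple ?posrE ?expR_gt0 //; last by lra.
apply: le_trans (expR_ge1Dx _); rewrite -[(1 - X)^-1]mul1r ler_pdivrMr; last by lra.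
nra.
Qed.

(** [rho], [gam] and [tau] are sine, cosine and tangent of the cap angle. The summand 64 forces
    tau^2 <= 1/4, while tau^2 d <= 16 keeps all d-th powers bounded. The exponent 76 is 58 from t,
    17 from (1 + e) / gam and 1 from [expR 1]. *)
Lemma radius_constants (d : nat) (tau : R) : (1 < d)%N -> 0 < tau ->
  tau ^+ 2 * (d%:R + 64) <= 16 ->
  exists rho gam t e : R,
    [/\ [/\ 0 < rho, rho < 1, 0 < gam, gam <= 1 & gam ^+ 2 = 1 - rho ^+ 2],
     [/\ 0 < t, 0 < e, e <= 1,
       1 - ((1 + e) / gam) ^- 2 <= rho ^+ 2 * (1 + d%:R^-1) &
       t * (1 + 25 / d%:R) + (4 * d%:R)^-1 <= 1 - rho ^+ 2] &
     [/\ tau = rho / gam, expR (- 16) <= gam ^+ d.+1 &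
       expR (- 76) / 8 <= t ^+ d / (8 * expR 1 * ((1 + e) / gam) ^+ d.+1)]].
Proof.
move=> d1 t0 Ht.
have d2 : 2 <= d%:R :> R by rewrite (ler_nat _ 2).
have s0 : 0 < tau ^+ 2 by rewrite exprn_gt0.
set s := tau ^+ 2 in Ht s0 *.
have s4 : s <= 1/4 by nra.
have sd : s * d%:R <= 16 by nra.
have sD : s * d.+1%:R <= 16 by rewrite -natr1; nra.
pose gam := (Num.sqrt (1 + s))^-1.
have gE : gam ^+ 2 = (1 + s)^-1 by rewrite exprVn sqr_sqrtr // addr_ge0 // ltW.
have g0 : 0 < gam by rewrite invr_gt0 sqrtr_gt0 addr_gt0.
have is1 : 0 < (1 + s)^-1 by rewrite invr_gt0; lra.
have isE : (1 + s) * (1 + s)^-1 = 1 by rewrite divff //; lra.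
have g1 : gam <= 1.
  rewrite -(@ler_pXn2r _ 2) ?nnegrE ?(ltW g0) // expr1n gE; nra.
pose rho := tau * gam.
have r0 : 0 < rho by rewrite mulr_gt0.
have rE : rho ^+ 2 = s * (1 + s)^-1 by rewrite exprMn gE.
have rs : rho ^+ 2 <= s by rewrite rE; nra.
have r20 : 0 < rho ^+ 2 by rewrite exprn_gt0.
have gr : gam ^+ 2 = 1 - rho ^+ 2 by rewrite gE rE; lra.
have di0 : 0 < d%:R^-1 :> R by rewrite invr_gt0; lra.
have dd : d%:R * d%:R^-1 = 1 :> R by rewrite divff //; lra.
have di1 : d%:R^-1 <= 1/2 :> R by nra.
(* Then 2 e = rho^2 / d is exactly the room that the circumradius condition leaves above rho^2. *)
pose e := rho ^+ 2 * d%:R^-1 / 2.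
have e0 : 0 < e by rewrite !mulr_gt0.
have e1 : e <= 1 by rewrite /e; nra.
pose X := rho ^+ 2 + d%:R^-1 / 4.
have X0 : 0 <= X by rewrite /X; lra.
have X1 : X <= 1/2 by rewrite /X; lra.
have XP : 0 < 1 - X by lra.
have u0 : 0 < 1 + 25 * d%:R^-1 :> R by lra.
(* This gives equality in the condition on t. *)
pose t := (1 - X) / (1 + 25 * d%:R^-1).
have tp : 0 < t by rewrite divr_gt0.
have gD : expR (- 16) <= gam ^+ d.+1.
  apply: (@le_trans _ _ ((gam ^+ 2) ^+ d.+1)); last first.
    by apply: lerXn2r; rewrite ?nnegrE ?exprn_ge0 ?(ltW g0) // expr2 ler_piMl // ltW.
  apply: (@le_trans _ _ (expR (- s * d.+1%:R))); first by rewrite ler_expR mulNr lerN2.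
  apply: expR_le_expr; rewrite expRN gE lef_pV2 ?posrE ?expR_gt0 //; last by lra.
  exact: expR_ge1Dx.
exists rho, gam, t, e; split; split=> //.
- rewrite -(@ltr_pXn2r _ 2) ?nnegrE ?(ltW r0) // expr1n; lra.
- rewrite exprMn exprVn.
  have -> : ((1 + e) ^+ 2 * (gam ^+ 2)^-1)^-1 = gam ^+ 2 / (1 + e) ^+ 2
    by rewrite invfM invrK mulrC.
  have h : 1 - 2 * e <= ((1 + e) ^+ 2)^-1.
    rewrite -[X in _ <= X]mul1r ler_pdivlMr ?exprn_gt0 //; last by lra.
    have -> : (1 - 2 * e) * (1 + e) ^+ 2 = 1 - e ^+ 2 * (3 + 2 * e) by ring.
    by rewrite gerBl mulr_ge0 ?sqr_ge0 //; lra.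
  have h2 : 2 * e = rho ^+ 2 * d%:R^-1 by rewrite /e; lra.
  have h3 : 0 <= gam ^+ 2 <= 1 by rewrite sqr_ge0 /= expr_le1 // ltW.
  move/andP: h3 => [h3 h4].
  apply: (@le_trans _ _ (1 - gam ^+ 2 * (1 - 2 * e))); first by rewrite lerD2l lerN2 ler_wpM2l.
  have -> : rho ^+ 2 * (1 + d%:R^-1) = rho ^+ 2 + 2 * e by rewrite h2; ring.
  move: (gam ^+ 2) gr h4 => G -> h4; nra.
- by rewrite divfK ?gt_eqF // invfM /X [4^-1 * _]mulrC; lra.
- by rewrite /rho mulfK // gt_eqF.
have HD : ((1 + e) / gam) ^+ d.+1 <= expR 17.
  rewrite exprMn exprVn ler_pdivrMr ?exprn_gt0 //.
  apply: (@le_trans _ _ (expR 17 * expR (- 16))); last by rewrite ler_wpM2l ?expR_ge0.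
  rewrite -expRD; apply: le_trans (expr_le_expR d.+1 _ (expR_ge1Dx e)) _; first by lra.
  have -> : e * d.+1%:R = rho ^+ 2 * (d%:R * d%:R^-1 + d%:R^-1) / 2.
    by rewrite /e -natr1; ring.
  rewrite ler_expR dd; nra.
(* 58 = 33 + 25: the numerator loses 2 X d <= 32.5, the denominator at most 25. *)
have tD : expR (- 58) <= t ^+ d.
  rewrite exprMn exprVn ler_pdivlMr ?exprn_gt0 //.
  apply: (@le_trans _ _ (expR (- 33))).
    apply: (@le_trans _ _ (expR (- 58) * expR 25)); last by rewrite -expRD ler_expR; lra.
    rewrite ler_wpM2l ?expR_ge0 //.
    apply: le_trans (expr_le_expR d _ (expR_ge1Dx _)) _; first by lra.
    by rewrite ler_expR -mulrA [_^-1 * _]mulrC dd mulr1.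
  apply: le_trans (expR_le_expr d (expRN2_le X0 X1)).
  rewrite ler_expR /X; nra.
have Hp : 0 < ((1 + e) / gam) ^+ d.+1 by rewrite exprn_gt0 // divr_gt0 // addr_gt0.
have ep := @expR_gt0 R.
rewrite ler_pdivlMr ?mulr_gt0 //; apply: le_trans tD.
rewrite (_ : - 58 = - 76 + 1 + 17); last by lra.
rewrite (expRD (- 76 + 1) 17) (expRD (- 76) 1).
have -> : expR (- 76) / 8 * (8 * expR 1 * ((1 + e) / gam) ^+ d.+1) =
  expR (- 76) * expR 1 * ((1 + e) / gam) ^+ d.+1 by field.
by apply: ler_wpM2l => //; rewrite mulr_ge0 ?expR_ge0.
Qed.

Definition density_const : R := expR (- 76) / 8.

Lemma density_const_gt0 : 0 < density_const. Proof. by rewrite divr_gt0 ?expR_gt0. Qed.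

(** The caps are too small to cover, so some direction w is outside all of them, and then the cap of
    the same angle around w contains none of the points. The upper estimate of [capcone_bounds]
    refutes covering, the lower one measures the cap found. *)
Lemma exists_empty_cap (d n : nat) (x : 'I_n -> 'rV[R]_d.+1) (tau : R) : (1 < d)%N -> (0 < n)%N ->
  (forall i, inner (x i) (x i) = 1) -> 0 < tau -> tau ^+ 2 * (d%:R + 64) <= 16 ->
  n%:R * (tau ^+ d * vol (@vcone R d 1 1)) < density_const * d.+1%:R * vol (ball1 R d.+1) ->
  exists A, [/\ caps R d A, A `&` range x = set0 &
    ((expR (- 16) * tau ^+ d * vol (@vcone R d 1 1) / vol (ball1 R d.+1))%:E <= sigma A)%E].
Proof.
move=> d1 n0 x1 t0 Ht Hn.
have [rho [gam [t [e [[r0 r1 g0 g1 gE] [tp e0 e1 He Hte] [tauE gD tD]]]]]] :=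
  radius_constants d1 t0 Ht.
have b0 := vol_ball1_gt0 R d.
have ncov : ~ forall w, exists i, gam * Num.sqrt (inner w w) <= inner w (x i).
  move=> cov; have := covering_density x1 d1 r0 r1 g0 gE tp e0 e1 He Hte cov.
  apply/negP; rewrite -ltNge.
  apply: (@le_lt_trans _ _ (n%:R * (tau ^+ d * vol (@vcone R d 1 1)))).
    rewrite mulr_natl -[X in _ *+ X]card_ord -sumr_const; apply: ler_sum => i _.
    by rewrite tauE; have /andP[] := capcone_bounds (x1 i) g0 r0 gE.
  by apply: lt_le_trans Hn _; rewrite ler_wpM2r ?(ltW b0) // ler_wpM2r.
have [w Hw] : exists w, forall i, inner w (x i) < gam * Num.sqrt (inner w w).
  have /existsNP[w Hw] := ncov; exists w => i; rewrite ltNge; apply/negP => h.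
  by apply: Hw; exists i.
have w0 : w != 0.
  apply/eqP => w0; have := Hw (Ordinal n0).
  by rewrite w0 !inner0l sqrtr0 mulr0 ltxx.
pose v := (Num.sqrt (inner w w))^-1 *: w.
have v1 : inner v v = 1 by exact: inner_normalize.
have s0 : 0 < Num.sqrt (inner w w) by rewrite sqrtr_gt0 inner_gt0.
have hg : -1 <= gam <= 1 by rewrite g1 andbT; lra.
exists (cap v (acos gam)); split.
- exists v, (acos gam); split=> //; first exact/sphereE.
  by rewrite acos_ge0 ?acos_lepi.
- apply/seteqP; split=> z // [/(cap_acosE _ v1 hg)[_ hz] [i _ iz]].
  move: hz; rewrite -iz innerZl mulrC ler_pdivlMr //.
  by rewrite leNgt Hw.
rewrite sigma_cap //; last by rewrite g1 ltW.
rewrite lee_fin ler_wpM2r ?invr_ge0 ?(ltW b0) //.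
have /andP[h _] := capcone_bounds v1 g0 r0 gE; apply: le_trans h.
by rewrite tauE ler_wpM2r ?vol_ge0 // ler_wpM2r // exprn_ge0 // divr_ge0 ?(ltW r0) ?(ltW g0).
Qed.

Lemma powR_half_sqr (d : nat) : (0 < d)%N ->
  (d%:R `^ ((d%:R + 3) / 2)) ^+ 2 = d%:R ^+ (d + 3) :> R.
Proof.
move=> d0; rewrite -powR_mulrn ?powR_ge0 // -powRrM divfK // -natrD.
by rewrite powR_mulrn.
Qed.

End constants.

Theorem theorem1p9 (R : realType) :
  exists c0 C : R,
    [/\ 0 < c0, 0 < C &
        forall d n : nat, (2 <= d)%N ->
          C * d%:R `^ ((d%:R + 3) / 2) * ln d%:R <= n%:R ->
          ((c0 * d%:R)%:E <= n%:R%:E * disp_caps R n d)%E].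
Proof.
have kp := density_const_gt0 R; have ln2 : 0 < ln 2 :> R by rewrite ln_gt0 // ltr1n.
(* [expR (- 16)] is lost in passing from a flat to a round top. Dividing by [ln 2] makes the
   logarithm a factor at least 1, and [4 * expR 32] is what the bound on [tau] consumes. *)
exists (expR (- 16) * density_const R), (4 * expR 32 / ln 2); split.
- by rewrite mulr_gt0 ?expR_gt0.
- by rewrite !mulr_gt0 ?expR_gt0 // invr_gt0.
move=> d n d2 Hn.
have dR : 2 <= d%:R :> R by rewrite (ler_nat _ 2).
have d0 : 0 < d%:R :> R by lra.
have lnd : ln 2 <= ln d%:R :> R by rewrite ler_ln ?posrE.
set P := d%:R `^ ((d%:R + 3) / 2) in Hn.
have P0 : 0 < P by exact: powR_gt0.
have PE : P ^+ 2 = d%:R ^+ (d + 3) by apply: powR_half_sqr; exact: ltnW.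
have {}Hn : 4 * expR 32 * P <= n%:R.
  apply: le_trans Hn; rewrite [leRHS]mulrAC ler_wpM2r ?(ltW P0) //.
  by rewrite -[leRHS]mulrA ler_peMr ?mulr_ge0 ?expR_ge0 // mulrC ler_pdivlMr // mul1r.
have nR : 0 < n%:R :> R.
  by apply: lt_le_trans Hn; rewrite !mulr_gt0 ?expR_gt0.
have n0 : (0 < n)%N by rewrite -(ltr0n R).
have b0 := vol_ball1_gt0 R d.
have vb := vol_vcone_ge R d.
set E := vol (vcone 1 1) in vb; set B := vol (ball1 R d.+1) in b0 vb.
have E0 : 0 < E.
  by rewrite -(pmulr_rgt0 _ (exprn_gt0 d.+1 (ltr0Sn R 3))); apply: lt_le_trans vb.
(* With [tau ^+ d = a], the n flat-topped cones have total volume [density_const * d * B]; the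
   covering bound has d + 1 in place of d, so the inequality [Hlt] is strict. *)
pose a := density_const R * d%:R * B / (n%:R * E).
have a0 : 0 < a by rewrite divr_gt0 ?mulr_gt0.
pose tau := a `^ d%:R^-1.
have tau0 : 0 < tau by exact: powR_gt0.
have tauE : tau ^+ d = a.
  by rewrite -powR_mulrn ?powR_ge0 // -powRrM mulVf ?gt_eqF // powRr1 // ltW.
have c21 : density_const R <= 1.
  rewrite /density_const ler_pdivrMr // mul1r; apply: (@le_trans _ _ 1); last by rewrite ler1n.
  by rewrite -[leRHS]expR0 ler_expR; lra.
(* Otherwise 16^d < a^2 (d + 64)^d. The left side absorbs the square of the 4^d from [vol_vcone_ge],
   and (1 + 64/d)^d <= e^64 is absorbed by the square of [expR 32]. *)
have Ht : tau ^+ 2 * (d%:R + 64) <= 16.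
  rewrite leNgt; apply/negP => h.
  have h1 : 16 ^+ d < a ^+ 2 * (d%:R + 64) ^+ d.
    rewrite -tauE -exprM mulnC exprM -exprMn ltr_pXn2r ?nnegrE ?(ltnW d2) //.
    exact: ltW (lt_trans _ h).
  have h2 : (d%:R + 64 : R) ^+ d <= d%:R ^+ d * expR 64.
    have -> : d%:R + 64 = d%:R * (1 + 64 * d%:R^-1) :> R by field; rewrite gt_eqF.
    rewrite exprMn ler_wpM2l ?exprn_ge0 ?(ltW d0) //.
    apply: le_trans (expr_le_expR d _ (expR_ge1Dx _)) _.
      by rewrite addr_ge0 // mulr_ge0 // invr_ge0 ltW.
    by rewrite -mulrA mulVf ?gt_eqF // mulr1.
  have h3 : a <= d%:R * 4 ^+ d.+1 / n%:R.
    rewrite /a ler_pdivrMr ?mulr_gt0 //.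
    have -> : d%:R * 4 ^+ d.+1 / n%:R * (n%:R * E) = d%:R * (4 ^+ d.+1 * E).
      by field; rewrite gt_eqF.
    rewrite [density_const R * _]mulrC -mulrA ler_wpM2l ?(ltW d0) //.
    by apply: le_trans vb; rewrite ler_piMl // ltW.
  have h4 : a ^+ 2 <= (d%:R * 4 ^+ d.+1 / n%:R) ^+ 2.
    by apply: lerXn2r; rewrite ?nnegrE ?(ltW a0) // divr_ge0 // mulr_ge0 ?exprn_ge0 // ltW.
  have h5 : (4 * expR 32 * P) ^+ 2 <= n%:R ^+ 2.
    by apply: lerXn2r; rewrite ?nnegrE // !mulr_ge0 ?expR_ge0 // ltW.
  move: h1; apply/negP; rewrite -leNgt.
  apply: (@le_trans _ _ ((d%:R * 4 ^+ d.+1 / n%:R) ^+ 2 * (d%:R ^+ d * expR 64))).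
    by apply: ler_pM; rewrite ?sqr_ge0 // exprn_ge0 // addr_ge0 // ltW.
  rewrite exprMn exprVn mulrAC ler_pdivrMr ?exprn_gt0 //.
  apply: (@le_trans _ _ (16 ^+ d * (4 * expR 32 * P) ^+ 2)); last first.
    by rewrite ler_wpM2l ?exprn_ge0.
  have -> : (4 * expR 32 * P) ^+ 2 = 16 * (expR 64 * d%:R ^+ (d + 3)).
    by rewrite !exprMn PE -expRM_natr (_ : 32 * 2 = 64 :> R) ?mulrA //; [congr (_ * _ * _)|]; ring.
  have -> : (d%:R * 4 ^+ d.+1) ^+ 2 * (d%:R ^+ d * expR 64) =
     16 ^+ d * (16 * (expR 64 * d%:R ^+ (d + 2))) :> R.
    rewrite exprMn -exprM (mulnC d.+1 2) (exprM 4 2 d.+1) (_ : 4 ^+ 2 = 16 :> R); last by ring.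
    by rewrite (exprS 16 d) (exprD _ d 2); ring.
  rewrite !ler_wpM2l ?exprn_ge0 ?expR_ge0 // ler_weXn2l ?leq_add2l //.
  by rewrite ler1n ltnW.
have nE : n%:R * (tau ^+ d * E) = density_const R * d%:R * B.
  by rewrite tauE /a; field; rewrite !gt_eqF.
have Hlt : n%:R * (tau ^+ d * E) < density_const R * d.+1%:R * B.
  by rewrite nE ltr_pM2r // ltr_pM2l // ltr_nat.
have key : ((expR (- 16) * density_const R * d%:R / n%:R)%:E <= disp_caps R n d)%E.
  apply: le_ereal_inf_tmp => _ [x osimplex ->].
  have x1 i : inner (x i) (x i) = 1 by apply/sphereE; exact: osimplex.
  have [A [cA Ax sA]] := exists_empty_cap d2 n0 x1 tau0 Ht Hlt.
  apply: le_trans (_ : (sigma A <= _)%E); last by apply: ereal_sup_ubound; exists A.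
  apply: le_trans sA; rewrite lee_fin -/E -/B le_eqVlt; apply/orP; left; apply/eqP.
  by rewrite tauE /a; field; rewrite !gt_eqF.
apply: le_trans (_ : (n%:R%:E * (expR (- 16) * density_const R * d%:R / n%:R)%:E <= _)%E).
  rewrite -EFinM lee_fin le_eqVlt; apply/orP; left; apply/eqP; field.
  by rewrite gt_eqF.
by rewrite lee_pmul2l // lte_fin.
Qed.
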